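(* Let $p$ be a prime number, let $k$ be a field of characteristic $p$, and let $K$ be a completed algebraic closure of the power series field $k((t))$. Then there exists a continuous $k$-linear (field) homomorphism $\tau: K \to K$ which is not an isomorphism.
   Context: The field $k((t))$ of formal Laurent series over $k$ carries its $t$-adic nonarchimedean absolute value (trivial on $k$, with $0<|t|<1$). A completed algebraic closure of $k((t))$ is the completion of an algebraic closure of $k((t))$ with respect to the unique extension of this absolute value. Continuity of $\tau$ refers to the topology on $K$ defined by the absolute value. *)

(* Defs.v *)
From HB Require Import structures.
From mathcomp Require Import all_boot all_order all_algebra.
From mathcomp Require Import all_classical all_reals topology.
From mathcomp Require Import zify.

Set Implicit Arguments.
Unset Strict Implicit.
Unset Printing Implicit Defensive.
Import Order.TTheory GRing.Theory Num.Theory.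
Local Open Scope classical_set_scope.
Local Open Scope ring_scope.

(* The formal Laurent series \sum_n f_n t^n is encoded by n |-> f_n. *)
Record laurent (k : fieldType) := Laurent {
  lcoef :> int -> k ;
  lcoefP : exists m : int, forall n, n < m -> lcoef n = 0 }.

HB.instance Definition _ (k : fieldType) := gen_eqMixin (laurent k).
HB.instance Definition _ (k : fieldType) := gen_choiceMixin (laurent k).

Section LaurentField.
Variable k : fieldType.
Implicit Types f g h : laurent k.

Lemma laurent_ext f g : f =1 g -> f = g.
Proof.
case: f g => [f fP] [g gP] /= /funext fg; move: gP; rewrite -fg => gP.
by congr Laurent; exact: Prop_irrelevance.
Qed.

Fact lzero_subproof : exists m : int, forall n, n < m -> (0 : k) = 0.
Proof. by exists 0. Qed.
Definition lzero := Laurent (lcoef := fun=> 0) lzero_subproof.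

Fact lconst_subproof (a : k) :
  exists m : int, forall n, n < m -> (if n == 0 then a else 0) = 0.
Proof. by exists 0 => n n0; rewrite lt_eqF. Qed.
Definition lconst (a : k) : laurent k :=
  Laurent (lcoef := fun n : int => if n == 0 then a else 0) (lconst_subproof a).

Fact ladd_subproof f g : exists m : int, forall n, n < m -> f n + g n = 0.
Proof.
have [[m fm] [m' gm']] := (lcoefP f, lcoefP g).
by exists (Order.min m m') => n; rewrite lt_min => /andP[/fm-> /gm'->]; rewrite addr0.
Qed.
Definition ladd f g := Laurent (ladd_subproof f g).

Fact lopp_subproof f : exists m : int, forall n, n < m -> - f n = 0.
Proof. by have [m fm] := lcoefP f; exists m => n /fm->; rewrite oppr0. Qed.
Definition lopp f := Laurent (lopp_subproof f).

(* A finitely supported sum: f_i g_(n - i) vanishes for i << 0 and i >> 0. *)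
Definition lconv (f g : int -> k) (n : int) : k :=
  \sum_(i \in [set: int]) f i * g (n - i).

Let below (m : int) (f : int -> k) := forall n, n < m -> f n = 0.

Lemma lconv_below m m' (f g : int -> k) :
  below m f -> below m' g -> below (m + m') (lconv f g).
Proof.
move=> fm gm' n nm; rewrite /lconv fsbig1// => i _.
have [im|mi] := ltP i m; first by rewrite fm// mul0r.
by rewrite gm' ?mulr0//; lia.
Qed.

Lemma lconvE m m' (f g : int -> k) r : below m f -> below m' g ->
  lconv f g (r%:Z + (m + m')) =
  \sum_(i < r.+1) f (i%:Z + m) * g ((r - i)%N%:Z + m').
Proof.
move=> fm gm'; pose s := [seq i%:Z + m | i <- iota 0 r.+1].
have us : uniq s.
  by rewrite map_inj_uniq ?iota_uniq// => i j /addIr[].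
rewrite /lconv -(fsbig_widen [set` s])//; last first.
  move=> i [_ nis]; rewrite /preimage /=.
  have [im|mi] := ltP i m; first by rewrite fm// mul0r.
  rewrite gm' ?mulr0// ltNge; apply/negP => lem; apply: nis => /=.
  by apply/mapP; exists `|i - m|%N; rewrite ?mem_iota; lia.
rewrite -fsbig_seq// big_map -[iota 0 _]/(index_iota 0 r.+1) big_mkord.
by apply: eq_bigr => i _; congr (_ * g _); have := ltn_ord i; lia.
Qed.

Fact lmul_subproof f g : exists m : int, forall n, n < m -> lconv f g n = 0.
Proof.
have [[m fm] [m' gm']] := (lcoefP f, lcoefP g).
by exists (m + m'); exact: lconv_below.
Qed.
Definition lmul f g := Laurent (lmul_subproof f g).

Let trunc (L : nat) (m : int) (f : int -> k) := \poly_(i < L) f (i%:Z + m).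

Lemma lconv_trunc L m m' (f g : int -> k) r :
  below m f -> below m' g -> (r < L)%N ->
  lconv f g (r%:Z + (m + m')) = (trunc L m f * trunc L m' g)`_r.
Proof.
move=> fm gm' rL; rewrite (lconvE _ fm gm') coefM; apply: eq_bigr => i _.
have iL : (i < L)%N := leq_ltn_trans (leq_ord i) rL.
have riL : (r - i < L)%N := leq_ltn_trans (leq_subr i r) rL.
by rewrite /trunc !coef_poly iL riL.
Qed.

Lemma lconv_below_ext (m : int) (f g : int -> k) : below m f -> below m g ->
  (forall r : nat, f (r%:Z + m) = g (r%:Z + m)) -> f =1 g.
Proof.
move=> fm gm fg n; have [nm|mn] := ltP n m; first by rewrite fm ?gm.
by have := fg `|n - m|%N; rewrite gez0_abs ?subr_ge0// subrK.
Qed.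

Lemma laddA : associative ladd.
Proof. by move=> f g h; apply: laurent_ext => n; rewrite /= addrA. Qed.

Lemma laddC : commutative ladd.
Proof. by move=> f g; apply: laurent_ext => n; rewrite /= addrC. Qed.

Lemma ladd0 : left_id lzero ladd.
Proof. by move=> f; apply: laurent_ext => n; rewrite /= add0r. Qed.

Lemma laddN : left_inverse lzero lopp ladd.
Proof. by move=> f; apply: laurent_ext => n; rewrite /= addNr. Qed.

Lemma lmulC : commutative lmul.
Proof.
move=> f g; have [[m fm] [m' gm']] := (lcoefP f, lcoefP g).
apply/laurent_ext/(@lconv_below_ext (m + m')).
- exact: lconv_below.
- by rewrite addrC; exact: lconv_below.
- move=> r /=; rewrite (lconv_trunc fm gm' (ltnSn r)) mulrC.
  by rewrite -(lconv_trunc gm' fm) 1?[m' + m]addrC.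
Qed.

Lemma lmulA : associative lmul.
Proof.
move=> f g h; have [m fm] := lcoefP f; have [m' gm'] := lcoefP g.
have [m'' hm''] := lcoefP h.
have fgm := lconv_below fm gm'; have ghm := lconv_below gm' hm''.
apply/laurent_ext/(@lconv_below_ext (m + m' + m'')).
- by rewrite -addrA; exact: lconv_below.
- exact: lconv_below.
- move=> r /=; rewrite -{1}addrA.
  rewrite (lconv_trunc fm ghm (ltnSn r)) (lconv_trunc fgm hm'' (ltnSn r)).
  pose L := r.+1.
  pose F := trunc L m f; pose G := trunc L m' g; pose H := trunc L m'' h.
  transitivity (F * (G * H))`_r.
    rewrite !coefM; apply: eq_bigr => i _; congr (_ * _).
    rewrite coef_poly (_ : (r - i < r.+1)%N); last lia.
    by rewrite (lconv_trunc gm' hm'' (L := r.+1))//; lia.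
  rewrite mulrA !coefM; apply: eq_bigr => i _; congr (_ * _).
  by rewrite coef_poly ltn_ord (lconv_trunc fm gm' (ltn_ord i)).
Qed.

Lemma lmul1 : left_id (lconst 1) lmul.
Proof.
move=> f; have [m fm] := lcoefP f.
have b1 : below 0 (lconst 1) by move=> n n0 /=; rewrite lt_eqF.
apply/laurent_ext/(@lconv_below_ext (0 + m)) => [||r].
- exact: lconv_below.
- by rewrite add0r.
rewrite /= (lconvE _ b1 fm) big_ord_recl big1 => [|i _] /=.
  by rewrite addr0 mul1r subn0 add0r.
by rewrite mul0r.
Qed.

Lemma lmulDl : left_distributive lmul ladd.
Proof.
move=> f g h; have [a fa] := lcoefP f; have [b gb] := lcoefP g.
have [c hc] := lcoefP h; pose m := Order.min a b.
have fm : below m f by move=> n; rewrite lt_min => /andP[/fa].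
have gm : below m g by move=> n; rewrite lt_min => /andP[_ /gb].
have fgm : below m (ladd f g) by move=> n nm; rewrite /= fm ?gm ?addr0.
apply/laurent_ext/(@lconv_below_ext (m + c)) => [||r].
- exact: lconv_below.
- by move=> n nm; rewrite /= !(lconv_below _ hc nm) ?addr0.
rewrite /= (lconvE _ fgm hc) (lconvE _ fm hc) (lconvE _ gm hc) -big_split.
by apply: eq_bigr => i _; rewrite mulrDl.
Qed.

Lemma lone_neq0 : lconst 1 != lzero.
Proof.
by apply/eqP => /(congr1 (fun f : laurent k => f 0))/eqP /=; rewrite oner_eq0.
Qed.

HB.instance Definition _ :=
  GRing.isZmodule.Build (laurent k) laddA laddC ladd0 laddN.
HB.instance Definition _ :=
  GRing.Zmodule_isComNzRing.Build (laurent k) lmulA lmulC lmul1 lmulDl lone_neq0.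

Let invseq (u : nat -> k) := fix s (n : nat) : seq k :=
  if n is n'.+1 then
    rcons (s n') ((u 0)^-1 *
      ((n' == 0)%:R - \sum_(i < n') u i.+1 * (s n')`_(n' - i.+1)))
  else [::].

Let size_invseq u n : size (invseq u n) = n.
Proof. by elim: n => //= n IH; rewrite size_rcons IH. Qed.

Let nth_invseq u m n : (n < m)%N -> (invseq u m)`_n = (invseq u n.+1)`_n.
Proof.
elim: m => // m IH; rewrite ltnS leq_eqVlt => /predU1P[->//|nm].
by rewrite [LHS]/= nth_rcons size_invseq nm IH.
Qed.

Lemma fps_inv (u : nat -> k) : u 0 != 0 ->
  exists v : nat -> k,
    forall n, \sum_(i < n.+1) u i * v (n - i)%N = (n == 0)%:R.
Proof.
move=> u0; exists (fun n => (invseq u n.+1)`_n) => n.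
rewrite big_ord_recl subn0 [in X in X + _]/= nth_rcons size_invseq ltnn eqxx.
rewrite mulVKf// -[RHS](addrNK (\sum_(i < n) u i.+1 * (invseq u n)`_(n - i.+1))).
congr (_ + _); apply: eq_bigr => i _; congr (_ * _).
have ni : (n - bump 0 i < n)%N by have := ltn_ord i; rewrite /bump; lia.
by rewrite -(nth_invseq _ ni) /bump add1n.
Qed.

Definition is_lorder f (m : int) := f m != 0 /\ below m f.

Lemma is_lorder_exists f : f != 0 -> exists m, is_lorder f m.
Proof.
move=> f0; have [m fm] := lcoefP f.
have /ex_minnP[r fr rmin] : exists r : nat, f (r%:Z + m) != 0.
  apply: contra_neqP f0 => /forallNP nf; apply/laurent_ext.
  apply: (@lconv_below_ext m) => // r.
  by apply/eqP; rewrite -[_ == _]negbK; apply/negP/nf.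
exists (r%:Z + m); split=> // n nr; have [nm|mn] := ltP n m; first exact: fm.
apply/eqP; rewrite -[_ == _]negbK; apply/negP => fn.
have := rmin `|n - m|%N; rewrite gez0_abs ?subr_ge0// subrK => /(_ fn); lia.
Qed.

Lemma laurent_inv_exists f : f != 0 -> exists g, g * f = 1.
Proof.
move=> /is_lorder_exists[m [fm0 fm]].
have [|v uv] := @fps_inv (fun r => f (r%:Z + m)); first by rewrite add0r.
pose c n := if n + m is Posz r then v r else 0.
have cm : below (- m) c.
  by move=> n; rewrite /c; case E : (n + m) => [r|//] nm; lia.
have cP : exists a : int, forall n, n < a -> c n = 0 by exists (- m).
exists (Laurent cP); rewrite mulrC; apply/laurent_ext.
apply: (@lconv_below_ext (m - m)).
- exact: (lconv_below fm cm).
- by move=> n; rewrite subrr => n0 /=; rewrite lt_eqF.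
move=> r; rewrite [LHS](lconvE _ fm cm) subrr addr0.
transitivity (\sum_(i < r.+1) f (i%:Z + m) * v (r - i)%N).
  by apply: eq_bigr => i _; rewrite /c subrK.
by rewrite uv /=; case: r.
Qed.

Definition linv f : laurent k := xget 0 [set g | g * f = 1].

Lemma lmulVf f : f != 0 -> linv f * f = 1.
Proof. by move=> /laurent_inv_exists; exact: (@xgetPex _ 0 [set g | g * f = 1]). Qed.

Lemma linv0 : linv 0 = 0.
Proof.
apply: xgetPN => g /=; rewrite mulr0 => /esym/eqP.
by rewrite oner_eq0.
Qed.

HB.instance Definition _ :=
  GRing.ComNzRing_isField.Build (laurent k) lmulVf linv0.

(* The t-adic order of f; its value at 0 is irrelevant. *)
Definition lorder f : int := xget 0 (is_lorder f).

End LaurentField.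

(* The t-adic absolute value on k((t)), normalised by |t| = c. *)
Definition tadic_abs (k : fieldType) (R : realType) (c : R) (f : laurent k) : R :=
  if f == 0 then 0 else c ^ lorder f.

Record nonarch_absval (R : realType) (F : fieldType) (v : F -> R) : Prop := {
  absval_ge0 : forall x, 0 <= v x ;
  absval_eq0 : forall x, v x = 0 <-> x = 0 ;
  absvalM : forall x y, v (x * y) = v x * v y ;
  absvalD : forall x y, v (x + y) <= Num.max (v x) (v y) }.

(* Fields with a nonarchimedean absolute value, carrying the (pseudo)metric
   structure it induces.  MathComp's normedZmodType is not usable here: its
   axiom `|x *+ n| = `|x| *+ n fails in characteristic p. *)
HB.mixin Record isNonarchField (R : realType) K
    of GRing.Field K & PseudoMetric R K := {
  absv : K -> R ;
  absv_nonarch : nonarch_absval absv ;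
  ball_absv : forall (x : K) (e : R), ball x e = [set y | absv (x - y) < e] }.

#[short(type="nonarchFieldType")]
HB.structure Definition NonarchField (R : realType) :=
  {K of isNonarchField R K & GRing.Field K & PseudoMetric R K}.

#[short(type="completeNonarchFieldType")]
HB.structure Definition CompleteNonarchField (R : realType) :=
  {K of NonarchField R K & Complete K}.

(* The data exhibiting K as a completed algebraic closure of k((t)): an
   algebraic closure of k((t)), an absolute value on it extending the t-adic
   one, and an isometric embedding with dense image into the complete field K. *)
Record completed_alg_closure (R : realType) (k : fieldType) (c : R)
    (K : completeNonarchFieldType R) := {
  cac_closure : closedFieldType ;
  cac_emb : {rmorphism laurent k -> cac_closure} ;
  cac_algebraic : forall x : cac_closure, algebraicOver cac_emb x ;
  cac_abs : cac_closure -> R ;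
  cac_abs_nonarch : nonarch_absval cac_abs ;
  cac_abs_ext : forall f : laurent k, cac_abs (cac_emb f) = tadic_abs c f ;
  cac_compl : {rmorphism cac_closure -> K} ;
  cac_isometry : forall x : cac_closure, absv (cac_compl x) = cac_abs x ;
  cac_dense : dense (range cac_compl) }.

Definition cac_const (R : realType) (k : fieldType) (c : R)
    (K : completeNonarchFieldType R) (C : completed_alg_closure k c K)
    (a : k) : K :=
  cac_compl C (cac_emb C (lconst a)).

(* Main.v *)
From HB Require Import structures.
Require Import Defs.
From mathcomp Require Import all_boot all_order all_algebra.
From mathcomp Require Import all_classical all_reals topology.
From mathcomp Require Import zify ring exp.
Set Implicit Arguments.
Unset Strict Implicit.
Unset Printing Implicit Defensive.
Import Order.TTheory GRing.Theory Num.Theory.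
Local Open Scope classical_set_scope.
Local Open Scope ring_scope.

(* Let T = 1/t, so |T| > 1, let D_m = p^(2m+3), and consider the relations
     R_m(x, z):  x^(D_m) - x^(p^2+1) = z^(D_m) - z^(p+1),
   for which |x - z|^(D_m) = |T|^(p^2+1) if x and z are close to T.
   Given z, the derivative in x has size |T|^(p^2), the derivative in z has
   size |T|^p, so moving z moves the nearest solution x by a factor at most
   |T|^(p-p^2) < 1.  Solving R_0, ..., R_(n-1) backwards from T and letting n
   grow gives a sequence Y_0, Y_1, ... in K with R_m(Y_m, Y_(m+1)) and
   |Y_m - T| <= r_m, where r_m^(D_m) = |T|^(p^2+1), r_m > 1.  The map tau sends
   T to Y_0.

   If tau were onto, some a algebraic over k((t)) would satisfy
   |tau(a) - T| < 1, hence |tau(a) - Y_m| <= r_m for all m.  By a Krasner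
   argument applied to z |-> R_m(Y_m, z), whose roots are more than r_(m+1)
   apart, all Y_m = tau(eta_m) have eta_m in the closure of k((t))(a).  But
   |eta_(m+1) - eta_m| = |T|^((p^2+1)/D_m), an exponent in lowest terms with
   unbounded denominator, contradicting the finiteness of the degree of a. *)

(** * Nonarchimedean absolute values *)

(** Bernoulli's inequality makes the powers of [c^-1 = 1 + d] unbounded. *)
Lemma exp_small (R : realType) (c e : R) : 0 <= c < 1 -> 0 < e ->
  exists n, c ^+ n < e.
Proof.
move=> /andP[c0 c1] e0.
have [->|cn0] := eqVneq c 0; first by exists 1%N; rewrite expr1.
have ci : 1 < c^-1 by rewrite invf_gt1// lt_neqAle eq_sym cn0.
pose d := c^-1 - 1; have d0 : 0 < d by rewrite subr_gt0.
pose n := Num.bound (e^-1 / d); exists n.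
rewrite -[X in X < _]invrK -exprVn invf_plt ?posrE//; last first.
  by rewrite exprn_gt0// (lt_trans ltr01).
have bernoulli m : 1 + d *+ m <= c^-1 ^+ m.
  elim: m => [|m IH]; first by rewrite mulr0n addr0 expr0.
  rewrite exprS -[X in X * _](subrKC 1) mulrDl mul1r mulrSr addrA lerD//.
  by rewrite ler_peMr ?exprn_ege1// ltW.
apply: lt_le_trans (bernoulli n); rewrite ltr_wpDl//.
rewrite -mulr_natl -ltr_pdivrMr//.
by rewrite archi_boundP// divr_ge0 ?invr_ge0// ltW.
Qed.

Lemma le_geometric0 (R : realType) (y B q : R) : 0 <= q < 1 ->
  (forall n, y <= B * q ^+ n) -> y <= 0.
Proof.
move=> q1 hy; rewrite leNgt; apply/negP => y0.
have B0 : 0 < B by rewrite (lt_le_trans y0)//; have := hy 0%N; rewrite mulr1.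
have [n] := exp_small q1 (divr_gt0 y0 B0).
by rewrite ltr_pdivlMr// mulrC ltNge hy.
Qed.

Section Absval.
Variables (R : realType) (F : fieldType) (v : F -> R).
Hypothesis hv : nonarch_absval v.
Implicit Types (x y : F) (e : R).

Lemma absv0 : v 0 = 0. Proof. exact/(absval_eq0 hv). Qed.

Lemma absv_eq0 x : (v x == 0) = (x == 0).
Proof. by apply/eqP/eqP => /(absval_eq0 hv). Qed.

Lemma absv_gt0 x : (0 < v x) = (x != 0).
Proof. by rewrite lt_def (absval_ge0 hv) absv_eq0 andbT. Qed.

Lemma absv1 : v 1 = 1.
Proof.
have v0 : v 1 != 0 by rewrite absv_eq0 oner_neq0.
by apply: (mulfI v0); rewrite -(absvalM hv) !mulr1.
Qed.

Lemma absvX x n : v (x ^+ n) = v x ^+ n.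
Proof. by elim: n => [|n IH]; rewrite ?expr0 ?absv1// !exprS (absvalM hv) IH. Qed.

Lemma absvN x : v (- x) = v x.
Proof.
have N1 : v (- 1) = 1.
  apply/eqP; rewrite -(@eqrXn2 _ 2) ?(absval_ge0 hv)//.
  by rewrite -absvX sqrrN !expr1n absv1.
by rewrite -mulN1r (absvalM hv) N1 mul1r.
Qed.

Lemma absvV x : v x^-1 = (v x)^-1.
Proof.
have [->|x0] := eqVneq x 0; first by rewrite invr0 absv0 invr0.
have vx0 : v x != 0 by rewrite absv_eq0.
by apply: (mulfI vx0); rewrite -(absvalM hv) !divff// absv1.
Qed.

Lemma absv_distC x y : v (x - y) = v (y - x).
Proof. by rewrite -absvN opprB. Qed.

Lemma absvD_le x y e : v x <= e -> v y <= e -> v (x + y) <= e.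
Proof. by move=> xe ye; rewrite (le_trans (absvalD hv _ _))// ge_max xe. Qed.

Lemma absvD_lt x y e : v x < e -> v y < e -> v (x + y) < e.
Proof. by move=> xe ye; rewrite (le_lt_trans (absvalD hv _ _))// gt_max xe. Qed.

Lemma absvB_le x y e : v x <= e -> v y <= e -> v (x - y) <= e.
Proof. by move=> xe ye; rewrite absvD_le// absvN. Qed.

Lemma absvB_lt x y e : v x < e -> v y < e -> v (x - y) < e.
Proof. by move=> xe ye; rewrite absvD_lt// absvN. Qed.

Lemma absv_dist_le z x y e : v (x - z) <= e -> v (z - y) <= e -> v (x - y) <= e.
Proof. by move=> xe ye; rewrite -(subrKA z) absvD_le. Qed.

Lemma absv_dist_lt z x y e : v (x - z) < e -> v (z - y) < e -> v (x - y) < e.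
Proof. by move=> xe ye; rewrite -(subrKA z) absvD_lt. Qed.

Lemma absvDr x y : v x < v y -> v (x + y) = v y.
Proof.
move=> xy; apply/eqP; rewrite eq_le absvD_le ?(ltW xy)//= leNgt; apply/negP => h.
by have := absvB_lt h xy; rewrite addrAC subrr add0r ltxx.
Qed.

Lemma absv_eqr x y : v (x - y) < v y -> v x = v y.
Proof. by move=> /absvDr; rewrite subrK. Qed.

Lemma absv_sum (I : eqType) (r : seq I) (f : I -> F) e :
  0 <= e -> (forall i, i \in r -> v (f i) <= e) -> v (\sum_(i <- r) f i) <= e.
Proof.
move=> e0; elim: r => [|i r IH] fe; first by rewrite big_nil absv0.
rewrite big_cons absvD_le ?fe ?mem_head ?IH// => j jr.
by rewrite fe// inE jr orbT.
Qed.

Lemma absv_horner (P : {poly F}) x (b e : R) : 1 <= b -> v x <= b -> 0 <= e ->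
  (forall i, v P`_i <= e) -> v P.[x] <= e * b ^+ size P.
Proof.
move=> b1 xb e0 Pe; have b0 : 0 <= b by rewrite (le_trans _ b1).
rewrite horner_coef absv_sum ?mulr_ge0 ?exprn_ge0// => i _.
rewrite (absvalM hv) absvX ler_pM ?exprn_ge0 ?(absval_ge0 hv)//.
rewrite (le_trans (_ : _ <= b ^+ i))//; last by rewrite ler_weXn2l// ltnW.
by rewrite lerXn2r ?nnegrE ?(absval_ge0 hv).
Qed.

(** For [a] nearest to [x], every factor of P(x) has size at least |x - a|. Each term of P'/P = sum
    1/(x - b) then has size at most 1/|x - a|, whence the second bound; multiplied out, it also
    makes sense when [x] is a root. *)
Lemma nearest_root (rs : seq F) x : rs != [::] ->
  let P := \prod_(a <- rs) ('X - a%:P) in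
  exists a, [/\ a \in rs, v (x - a) ^+ size rs <= v P.[x]
    & v P^`().[x] * v (x - a) <= v P.[x]].
Proof.
move=> rs0 P.
have [a ars amin] : exists2 a, a \in rs & forall b, b \in rs -> v (x - a) <= v (x - b).
  elim: rs rs0 {P} => // b [|b' rs] IH _.
    by exists b => [|b']; rewrite !inE// => /eqP->.
  have [//|a ars amin] := IH; have [h|h] := leP (v (x - a)) (v (x - b)).
    by exists a => [|d]; rewrite inE ?ars ?orbT// => /orP[/eqP->//|/amin].
  exists b => [|d]; rewrite inE ?eqxx// => /orP[/eqP->//|/amin].
  exact/le_trans/ltW.
exists a; split=> //; rewrite /P {P ars rs0}; move: amin; set m := v (x - a) => amin.
- elim: rs amin => [|b rs IH] amin; first by rewrite big_nil hornerC absv1.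
  rewrite big_cons hornerM hornerXsubC (absvalM hv) exprS ler_pM ?exprn_ge0 ?(absval_ge0 hv)//.
    by rewrite amin ?mem_head.
  by apply: IH => d drs; rewrite amin// inE drs orbT.
- elim: rs amin => [|b rs IH] amin.
    by rewrite big_nil -(polyC1) derivC !hornerC absv0 mul0r (absval_ge0 hv).
  rewrite big_cons derivM derivXsubC mul1r hornerD !hornerM hornerXsubC.
  set Q := \prod_(_ <- _) _; rewrite (absvalM hv).
  have {}IH : v Q^`().[x] * m <= v Q.[x].
    by apply: IH => d drs; rewrite amin// inE drs orbT.
  have m0 : 0 <= m by exact: (absval_ge0 hv).
  have := absvalD hv Q.[x] ((x - b) * Q^`().[x]).
  rewrite le_max => /orP[] h; rewrite (le_trans (ler_wpM2r m0 h))//.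
    by rewrite mulrC ler_wpM2r ?(absval_ge0 hv)// amin ?mem_head.
  by rewrite (absvalM hv) -mulrA ler_wpM2l ?(absval_ge0 hv).
Qed.

Lemma absv_eql x y : v (x - y) < v x -> v x = v y.
Proof. by rewrite absv_distC => /absv_eqr. Qed.

Lemma absv_geometric0 x (B q : R) : 0 <= q < 1 ->
  (forall n, v x <= B * q ^+ n) -> x = 0.
Proof.
move=> q1 /(le_geometric0 q1) h; apply/(absval_eq0 hv)/eqP.
by rewrite eq_le h (absval_ge0 hv).
Qed.

Lemma absvM_close x y x' y' d e : v (x - y) < d -> v (x' - y') < d ->
  d <= 1 -> (v x + v x' + 1) * d <= e -> v (x * x' - y * y') < e.
Proof.
have v0 := absval_ge0 hv.
move=> xd xd' d1; apply: lt_le_trans; set M := v x + v x' + 1.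
have M0 : 0 < M by rewrite ltr_wpDl ?addr_ge0.
have d0 : 0 < d := le_lt_trans (v0 _) xd.
have xM : v x <= M by rewrite /M -addrA lerDl addr_ge0.
have yM : v y' <= M.
  rewrite -[y'](subKr x') absvB_le//; last first.
    by rewrite (le_trans (ltW xd'))// (le_trans d1)// lerDr addr_ge0.
  by rewrite /M addrAC lerDr addr_ge0.
have -> : x * x' - y * y' = x * (x' - y') + (x - y) * y'.
  by rewrite mulrBr mulrBl subrKA.
rewrite absvD_lt// (absvalM hv).
  by rewrite (le_lt_trans (ler_wpM2r (v0 _) xM))// ltr_pM2l.
by rewrite mulrC (le_lt_trans (ler_wpM2r (v0 _) yM))// ltr_pM2l.
Qed.

End Absval.

Section Complete.
Variables (R : realType) (K : completeNonarchFieldType R).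
Let hK : nonarch_absval (@absv R K) := absv_nonarch.

Lemma complete_lim (x : nat -> K) (B q : R) : 0 <= B -> 0 <= q < 1 ->
  (forall n, absv (x n.+1 - x n) <= B * q ^+ n) ->
  exists l, forall n, absv (l - x n) <= B * q ^+ n.
Proof.
move=> B0 /andP[q0 q1] hx.
(* By the ultrametric inequality the bound on one step bounds all later displacements, without
   summing. *)
have hx' n m : absv (x (n + m)%N - x n) <= B * q ^+ n.
  elim: m => [|m IH]; first by rewrite addn0 subrr (absv0 hK) mulr_ge0 ?exprn_ge0.
  apply: (absv_dist_le hK) IH; rewrite addnS (le_trans (hx _))// ler_wpM2l//.
  by rewrite ler_wiXn2l// ?ltW// leq_addr.
have small e : 0 < e -> exists n, B * q ^+ n < e.
  move=> e0; have [n ne] := @exp_small R q (e / (B + 1)) ltac:(by rewrite q0) ltac:(by rewrite divr_gt0// ltr_pwDr).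
  exists n; rewrite (@le_lt_trans _ _ ((B + 1) * q ^+ n))//.
    by rewrite ler_wpM2r ?exprn_ge0// lerDl.
  by rewrite mulrC -ltr_pdivlMr// ltr_pwDr.
have xc : cvg (x @ \oo).
  apply/cauchy_cvgP; apply: cauchy_exP => e /small[n ne]; exists (x n); exists n => // m /= nm.
  rewrite ball_absv /= (absv_distC hK) (le_lt_trans _ ne)//.
  by rewrite -(subnKC nm) hx'.
exists (lim (x @ \oo)) => n; rewrite leNgt; apply/negP => lt.
have dpos : 0 < absv (lim (x @ \oo) - x n).
  by rewrite (le_lt_trans _ lt)// mulr_ge0 ?exprn_ge0.
have /cvg_ballP/(_ _ dpos)[N _ hN] := xc.
have := hN (maxn N n) (leq_maxl _ _); rewrite ball_absv /= => h.
have := absv_dist_lt hK h (_ : absv (x (maxn N n) - x n) < _).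
rewrite ltxx => h'; have //: false; apply: h'.
by rewrite (le_lt_trans _ lt)// -(subnKC (leq_maxr N n)) hx'.
Qed.

End Complete.

(** * Extending homomorphisms along algebraic extensions *)

Section Adjoin.
Variables (F A B : fieldType) (emb : {rmorphism F -> A}) (phi : {rmorphism F -> B}).
Hypothesis halg : forall x : A, algebraicOver emb x.

(** Graph of a ring homomorphism into [B] from a subring of [A] containing the image of [emb],
    compatible with [phi]. Working with graphs turns unions of chains of homomorphisms into unions
    of sets. *)
Definition partial_hom (G : set (A * B)) :=
  [/\ (forall f, G (emb f, phi f)), (forall x y, G x -> G y -> G (x - y)),
      (forall x y, G x -> G y -> G (x * y)) & forall y, G (0, y) -> y = 0].

Lemma partial_hom_horner G (P : {poly A * B}) x : partial_hom G ->
  (forall i, G P`_i) -> G x -> G P.[x].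
Proof.
move=> [Ge GB GM G0] GP Gx.
have Gz : G 0 by have := Ge 0; rewrite !rmorph0.
have GD a b : G a -> G b -> G (a + b).
  move=> Ga Gb; rewrite -(opprK b); apply: (GB) => //.
  by rewrite -sub0r; exact: GB.
elim/poly_ind: P GP => [|P c IH] GP; first by rewrite horner0.
rewrite hornerMXaddC; apply: GD; first apply: GM => //.
  by apply: IH => i; have := GP i.+1; rewrite coefD coefMX coefC addr0.
by have := GP 0%N; rewrite coefD coefMX coefC add0r.
Qed.

(** A nonzero algebraic [x] is a root of some [P] over [F] with nonzero constant term. Evaluating
    [P] at (x, 0) in the product ring puts (0, phi P_0) in [G], so P_0 = 0, a contradiction. *)
Lemma partial_hom_inj G x : partial_hom G -> G (x, 0) -> x = 0.
Proof.
move=> hG Gx; apply/eqP/negP => /negP x0.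
have [P P0 Px] : exists2 P : {poly F}, P`_0 != 0 & root (map_poly emb P) x.
  have [P P0 Px] := halg x.
  have [n] := ubnP (size P); elim: n => // n IH in P P0 Px *; rewrite ltnS => Pn.
  have [P00|] := eqVneq P`_0 0; last by exists P.
  have /factor_theorem[Q PQ] : root P 0 by rewrite /root horner_coef0 P00.
  rewrite subr0 in PQ; have Q0 : Q != 0 by apply: contraNneq P0 => Q0; rewrite PQ Q0 mul0r.
  apply: (IH Q) => //; last by move: Pn; rewrite PQ size_mulX.
  by move: Px; rewrite PQ rmorphM/= map_polyX rootM rootX (negPf x0) orbF.
have [Ge GB GM G0] := hG.
pose Q : {poly A * B} := \poly_(i < size P) (emb P`_i, phi P`_i).
have Qi i : Q`_i = (emb P`_i, phi P`_i).
  by rewrite coef_poly; case: ltnP => // Pi; rewrite nth_default// !rmorph0.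
have := partial_hom_horner (P := Q) hG _ Gx.
have -> : Q.[(x, 0)] = (0, phi P`_0).
  rewrite [LHS]surjective_pairing -!horner_map /=.
  have -> : map_poly fst Q = map_poly emb P.
    by apply/polyP => i; rewrite !coef_map Qi.
  have -> : map_poly snd Q = map_poly phi P.
    by apply/polyP => i; rewrite !coef_map Qi.
  by rewrite (eqP Px) horner_coef0 coef_map.
move=> h; have /G0/eqP : G (0, phi P`_0) by apply: h => i; rewrite Qi.
by rewrite fmorph_eq0 (negPf P0).
Qed.

Hypothesis hB : forall P : {poly B}, (1 < size P)%N -> exists x, root P x.

(** A polynomial [p] of least degree over [G] whose first projection kills [a] serves as minimal
    polynomial; [b] is any root of its second projection, and [G'] consists of the values at (a, b)
    of polynomials over [G]. *)
Lemma partial_hom_adjoin G a : partial_hom G ->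
  exists G' b, [/\ partial_hom G', G `<=` G' & G' (a, b)].
Proof.
move=> hG; have [Ge GB GM G0] := hG.
have Gz : G 0 by have := Ge 0; rewrite !rmorph0.
have G1 : G 1 by have := Ge 1; rewrite !rmorph1.
have GN x : G x -> G (- x) by rewrite -sub0r; exact: GB.
have GD x y : G x -> G y -> G (x + y).
  by move=> Gx Gy; rewrite -(opprK y); apply: GB => //; exact: GN.
pose over (P : {poly A * B}) := forall i, G P`_i.
have overB P Q : over P -> over Q -> over (P - Q).
  by move=> oP oQ i; rewrite coefB; exact: GB.
have overM P Q : over P -> over Q -> over (P * Q).
  by move=> oP oQ i; rewrite coefM; apply: big_ind => // j _; exact: GM.
have overC x : G x -> over x%:P by move=> Gx i; rewrite coefC; case: ifP.
have overX : over 'X by move=> i; rewrite coefX; case: (i == 1%N).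
have overXn n : over 'X^n by move=> i; rewrite coefXn; case: (i == n).
pose kill (P : {poly A * B}) := root (map_poly fst P) a.
have fst0 x : G x -> x.1 = 0 -> x = 0.
  by case: x => x y Gx /= x0; move: Gx; rewrite x0 => /G0 ->.
have snd0 x : G x -> x.2 = 0 -> x = 0.
  by case: x => x y Gx /= y0; move: Gx; rewrite y0 => /(partial_hom_inj hG) ->.
pose T n := exists P, [/\ over P, P != 0, kill P & size P = n].
have exT : exists n, `[< T n >].
  have [P P0 Pa] := halg a.
  pose Q : {poly A * B} := \poly_(i < size P) (emb P`_i, phi P`_i).
  have Qi i : Q`_i = (emb P`_i, phi P`_i).
    by rewrite coef_poly; case: ltnP => // Pi; rewrite nth_default// !rmorph0.
  have QP : map_poly fst Q = map_poly emb P by apply/polyP => i; rewrite !coef_map Qi.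
  exists (size Q); apply/asboolP; exists Q; split=> //; first by move=> i; rewrite Qi.
    apply: contraNneq P0 => Q0; rewrite -(map_poly_eq0 emb) -QP Q0.
    by rewrite raddf0.
  by rewrite /kill QP.
case: (ex_minnP exT) => n /asboolP[p [op p0 pa pn]] nmin.
have pmin Q : over Q -> kill Q -> (size Q < size p)%N -> Q = 0.
  move=> oQ kQ; rewrite ltnNge; apply: contraNeq => Q0; rewrite pn.
  by apply: nmin; apply/asboolP; exists Q.
(* This keeps the degree of [p] under the second projection, and later allows [lead_coef p] to be
   cancelled. *)
have lp0 : (lead_coef p).2 != 0.
  apply: contraNneq p0 => /snd0/eqP; rewrite lead_coef_eq0 => -> //.
  by rewrite lead_coefE.
have p1 : (1 < size p)%N.
  rewrite ltnNge; apply/negP => /size1_polyC pC.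
  move: pa; rewrite /kill pC map_polyC /root hornerC => /eqP /fst0 p00.
  by move: p0; rewrite pC p00 ?eqxx// ; exact: op.
have [b pb] : exists b, root (map_poly snd p) b.
  by apply: hB; rewrite size_poly_eq//.
have pab : p.[(a, b)] = 0.
  by rewrite [LHS]surjective_pairing -!horner_map /= (eqP pa) (eqP pb).
exists [set P.[(a, b)] | P in over], b; split; last 2 first.
- by move=> x Gx; exists x%:P; rewrite ?hornerC//; exact: overC.
- by exists 'X; rewrite ?hornerX.
split.
- by move=> f; exists (emb f, phi f)%:P; rewrite ?hornerC//; exact: overC.
- by move=> _ _ [P oP <-] [Q oQ <-]; exists (P - Q); rewrite ?hornerD ?hornerN//; exact: overB.
- by move=> _ _ [P oP <-] [Q oQ <-]; exists (P * Q); rewrite ?hornerM//; exact: overM.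
move=> y [P oP Py].
have Pa : kill P by rewrite /kill /root (horner_map fst P (a, b)) Py.
suff P2 : (P.[(a, b)]).2 = 0 by move: P2; rewrite Py.
have [m] := ubnP (size P); elim: m => // m IH in P oP {Py} Pa *; rewrite ltnS => Pm.
have [Pp|pP] := ltnP (size P) (size p); first by rewrite (pmin P) ?horner0.
pose d := (size P - size p)%N.
(* Pseudo-division by [p], since the coefficients range over a ring: [P'] is shorter than [P], and
   its value at (a, b) is that of [P] times [lead_coef p]. *)
pose P' := (lead_coef p)%:P * P - (lead_coef P)%:P * 'X^d * p.
have oP' : over P'.
  have oC : over (lead_coef p)%:P by exact/overC/op.
  have oC' : over (lead_coef P)%:P by exact/overC/oP.
  by apply: (overB); [apply: (overM) | apply: (overM) => //; apply: (overM)].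
have P'ab : P'.[(a, b)] = lead_coef p * P.[(a, b)].
  by rewrite hornerD hornerN !hornerM pab mulr0 subr0 hornerC.
have Pab1 : (P.[(a, b)]).1 = 0 by rewrite -(horner_map fst P (a, b)) (eqP Pa).
have P'a : kill P'.
  by rewrite /kill /root (horner_map fst P' (a, b)) P'ab /= Pab1 mulr0.
have P'm : (size P' < m)%N.
  rewrite (leq_trans _ Pm)// -(ltn_predK (leq_trans p1 pP)) ltnS; apply/leq_sizeP => j Pj.
  rewrite coefB -mulrA !coefCM mulrC coefXnM.
  have [->|jP] := eqVneq j (size P).-1.
    rewrite ltnNge (_ : (d <= _)%N); last by rewrite /d; lia.
    rewrite (_ : (_ - d)%N = (size p).-1); last by rewrite /d; lia.
    by rewrite -!lead_coefE subrr.
  have {}Pj : (size P <= j)%N.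
    by rewrite -(ltn_predK (leq_trans p1 pP)) ltn_neqAle eq_sym jP.
  rewrite nth_default// mul0r sub0r ltnNge (leq_trans (leq_subr _ _) Pj).
  by rewrite [p`_ _]nth_default ?mulr0 ?oppr0// -(subKn pP) leq_sub2r.
have := IH P' oP' P'a P'm; rewrite P'ab /= => /eqP.
by rewrite mulf_eq0 (negPf lp0) => /eqP.
Qed.

Lemma hom_extension : exists tau : {rmorphism A -> B}, forall f, tau (emb f) = phi f.
Proof.
pose good G := G = set0 \/ partial_hom G.
have [| G [hG Gmax]] := @Zorn_bigcup (A * B)%type good.
  move=> E Egood Etot.
  have [[X EX [x Xx]]|nE] := pselect (exists2 X, E X & X !=set0); last first.
    left; apply/seteqP; split=> // x [X EX Xx]; apply: nE.
    by exists X => //; exists x.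
  have Xh Y y : E Y -> Y y -> partial_hom Y.
    by move=> /Egood[->|].
  right; split.
  - by move=> f; exists X => //; have [] := Xh _ _ EX Xx.
  - move=> y z [Y EY Yy] [Z EZ Zz]; have [YZ|ZY] := Etot _ _ EY EZ.
      by exists Z => //; have [_ + _ _] := Xh _ _ EZ Zz; apply=> //; exact: YZ.
    by exists Y => //; have [_ + _ _] := Xh _ _ EY Yy; apply=> //; exact: ZY.
  - move=> y z [Y EY Yy] [Z EZ Zz]; have [YZ|ZY] := Etot _ _ EY EZ.
      by exists Z => //; have [_ _ + _] := Xh _ _ EZ Zz; apply=> //; exact: YZ.
    by exists Y => //; have [_ _ + _] := Xh _ _ EY Yy; apply=> //; exact: ZY.
  - by move=> y [Y EY Yy]; have [_ _ _ + ] := Xh _ _ EY Yy; exact.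
have {}hG : partial_hom G.
  case: hG => // G0; exfalso; have := Gmax (range (fun f => (emb f, phi f))).
  apply.
    by rewrite G0; split=> [//|h]; apply: (h (emb 0, phi 0)); exists 0.
  right; split.
  - by move=> f; exists f.
  - by move=> _ _ [f _ <-] [g _ <-]; exists (f - g); rewrite ?rmorphB.
  - by move=> _ _ [f _ <-] [g _ <-]; exists (f * g); rewrite ?rmorphM.
  - by move=> y [f _ [/eqP]]; rewrite fmorph_eq0 => /eqP -> <-; rewrite rmorph0.
have [Ge GB GM G0] := hG.
have Gtot x : exists y, G (x, y).
  have [G' [b [hG' GG' G'b]]] := partial_hom_adjoin x hG.
  have [G'G|G'G] := pselect (G' `<=` G); first by exists b; exact: G'G.
  by have := Gmax G' (conj GG' G'G) (or_intror hG').
have Guniq x y z : G (x, y) -> G (x, z) -> y = z.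
  move=> Gy Gz; apply/subr0_eq/G0.
  by have := GB _ _ Gy Gz; rewrite -[_ - _]/(x - x, y - z) subrr.
pose t x := sval (cid (Gtot x)).
have tG x : G (x, t x) := svalP (cid (Gtot x)).
have tB : zmod_morphism t.
  move=> x y; apply: Guniq (tG _) _.
  exact: (GB _ _ (tG x) (tG y)).
have tM : monoid_morphism t.
  split; first by apply: Guniq (tG _) _; have := Ge 1; rewrite !rmorph1.
  move=> x y; apply: Guniq (tG _) _.
  exact: (GM _ _ (tG x) (tG y)).
pose tZ := GRing.isZmodMorphism.Build A B t tB.
pose tR := GRing.isMonoidMorphism.Build A B t tM.
pose tau : {rmorphism A -> B} := HB.pack t tZ tR.
by exists tau => f; apply: Guniq (tG _) _; exact: Ge.
Qed.
End Adjoin.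

(** * Formal Laurent series *)

Section Laurent.
Variable k : fieldType.

Fact lmon_subproof (a : k) (m : int) :
  exists m' : int, forall n, n < m' -> (if n == m then a else 0) = 0.
Proof. by exists m => n nm; rewrite lt_eqF. Qed.
(** The monomial a t^m; [lmon 1 1] is t. *)
Definition lmon (a : k) (m : int) : laurent k :=
  Laurent (lcoef := fun n : int => if n == m then a else 0) (lmon_subproof a m).

Lemma lconstE a : lconst a = lmon a 0.
Proof. exact: laurent_ext. Qed.

Lemma lcoefB (f g : laurent k) n : (f - g) n = f n - g n. Proof. by []. Qed.


Lemma lcoef_sum (I : Type) (r : seq I) (P : pred I) (F : I -> laurent k) n :
  (\sum_(i <- r | P i) F i) n = \sum_(i <- r | P i) F i n.
Proof.
by apply: (big_morph (fun f : laurent k => f n)).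
Qed.

Lemma lcoef_mon a m (f : laurent k) n : (lmon a m * f) n = a * f (n - m).
Proof.
rewrite [LHS]/= /lconv -(fsbig_widen [set m])//.
  by rewrite fsbig_set1 eqxx.
by move=> i /= [_ /eqP/negPf ->]; rewrite mul0r.
Qed.

Lemma lmonM a b m n : lmon a m * lmon b n = lmon (a * b) (m + n).
Proof.
apply: laurent_ext => i; rewrite lcoef_mon /=.
by rewrite subr_eq addrC; case: eqP => //; rewrite mulr0.
Qed.

Lemma lmon1X m i : lmon 1 m ^+ i = lmon 1 (m * i%:Z).
Proof.
elim: i => [|i IH]; first by rewrite mulr0 expr0 -lconstE.
by rewrite exprS IH lmonM mulr1; congr lmon; lia.
Qed.

Fact lconst_is_zmod_morphism : zmod_morphism (@lconst k).
Proof.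
by move=> a b; apply: laurent_ext => n; rewrite lcoefB /=; case: eqP; rewrite ?subr0.
Qed.
Fact lconst_is_monoid_morphism : monoid_morphism (@lconst k).
Proof. by split=> // a b; rewrite !lconstE lmonM addr0. Qed.
HB.instance Definition _ := GRing.isZmodMorphism.Build k (laurent k)
  (@lconst k) lconst_is_zmod_morphism.
HB.instance Definition _ := GRing.isMonoidMorphism.Build k (laurent k)
  (@lconst k) lconst_is_monoid_morphism.

(** Laurent polynomials are written as t^m P(t); [tadic_dense] shows that they are dense. *)
Lemma lmon_poly (P : {poly k}) m n :
  (lmon 1 m * (map_poly (@lconst k) P).[lmon 1 1]) n =
  if n - m is Posz i then P`_i else 0.
Proof.
rewrite lcoef_mon mul1r horner_coef lcoef_sum size_map_poly.
transitivity (\sum_(i < size P) lmon P`_i i (n - m)).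
  apply: eq_bigr => i _; rewrite coef_map lmon1X [_ P`_i]lconstE lmonM.
  by rewrite mulr1 add0r mul1r.
rewrite /=; case: (n - m) => [j|j]; last first.
  by rewrite big1// => i _; case: eqP => //; lia.
have [jP|Pj] := ltnP j (size P).
  rewrite (bigD1 (Ordinal jP))//= eqxx big1 ?addr0// => i ij.
  by case: eqP => // -[ji]; move: ij; rewrite -val_eqE/= ji eqxx.
rewrite nth_default// big1// => i _; case: eqP => // -[ji].
by have := ltn_ord i; rewrite -ji ltnNge Pj.
Qed.

Section Tadic.
Variables (R : realType) (c : R).
Hypothesis hc : 0 < c < 1.
Let w : laurent k -> R := tadic_abs c.
Let c0 : 0 < c. Proof. by case/andP: hc. Qed.
Let c1 : c < 1. Proof. by case/andP: hc. Qed.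

Lemma tadic_order f m : is_lorder f m -> w f = c ^ m.
Proof.
move=> [fm fb]; have f0 : f != 0 by apply: contraNneq fm => ->.
rewrite /w /tadic_abs (negPf f0).
congr (_ ^ _); have [f1 f2] : is_lorder f (lorder f) by apply: xgetPex; exists m.
apply/eqP; rewrite eq_le !leNgt; apply/andP; split; apply/negP.
  by move=> /f2 h; rewrite h eqxx in fm.
by move=> /fb h; rewrite h eqxx in f1.
Qed.

Lemma tadic_value f : f != 0 -> exists m, w f = c ^ m.
Proof. by move=> /is_lorder_exists[m fm]; exists m; exact: tadic_order. Qed.

Lemma tadic_le f (m : int) : w f <= c ^ m <-> forall n, n < m -> f n = 0.
Proof.
have [->|f0] := eqVneq f 0.
  by rewrite /w /tadic_abs eqxx; split=> // _; rewrite exprz_ge0 ?ltW.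
have [d fd] := is_lorder_exists f0; rewrite (tadic_order fd).
have -> : (c ^ d <= c ^ m) = (m <= d).
  have E i : c ^ i = c^-1 ^ (- i) by rewrite exprz_inv opprK.
  by rewrite !E ler_eXz2l ?invf_gt1// lerN2.
split=> [md n nm|h]; first by apply: fd.2; exact: lt_le_trans md.
by rewrite leNgt; apply/negP => /h h'; have := fd.1; rewrite h' eqxx.
Qed.

Lemma tadic_mon a m : a != 0 -> w (lmon a m) = c ^ m.
Proof.
move=> a0; apply: tadic_order; split; first by rewrite /= eqxx.
by move=> n nm /=; rewrite lt_eqF.
Qed.

Lemma tadic_dense f e : 0 < e -> exists m (P : {poly k}),
  w (f - lmon 1 m * (map_poly (@lconst k) P).[lmon 1 1]) < e.
Proof.
move=> e0; have [N Ne] := @exp_small R c e ltac:(by rewrite ltW) e0.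
have [m fm] := lcoefP f; exists m, (\poly_(i < `|N%:Z - m|) f (i%:Z + m)).
rewrite (le_lt_trans _ Ne)//; apply/(tadic_le _ N%:Z) => n nN.
rewrite lcoefB lmon_poly; have [nm|mn] := ltP n m.
  by rewrite fm//; case E : (n - m) => [j|j]; rewrite ?subr0//; lia.
case E : (n - m) => [j|j]; last by lia.
by rewrite coef_poly (_ : (j < _)%N) -?E ?subrK ?subrr//; lia.
Qed.

Lemma laurent_complete (f : nat -> laurent k) :
  (forall j, w (f j.+1 - f j) <= c ^+ j) ->
  exists g, forall j, w (g - f j) <= c ^+ j.
Proof.
move=> hf.
have fS j (n : int) : n < j%:Z -> f j.+1 n = f j n.
  move=> nj; apply/subr0_eq; rewrite -lcoefB.
  by exact: (tadic_le _ j%:Z).1 (hf j) _ nj.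
have fE i j (n : int) : (i <= j)%N -> n < i%:Z -> f j n = f i n.
  move=> + ni; elim: j => [|j IH]; first by rewrite leqn0 => /eqP->.
  rewrite leq_eqVlt => /predU1P[->//|]; rewrite ltnS => ij.
  by rewrite fS ?IH//; lia.
have [m f0m] := lcoefP (f 0%N).
(* The coefficient at [n] no longer changes from stage |n| + 1 on, so it is read off there; for
   negative [n] it is already constant from stage 0. *)
have gP : exists m, forall n : int, n < m -> f (`|n|.+1)%N n = 0.
  exists (Order.min m 0) => n; rewrite lt_min => /andP[nm n0].
  by rewrite (fE 0%N)// f0m.
exists (Laurent gP) => j; apply/(tadic_le _ j%:Z) => n nj; rewrite lcoefB /=.
apply/eqP; rewrite subr_eq0; apply/eqP.
have [h|h] := leqP j (`|n|.+1)%N; first exact: fE.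
by rewrite (fE (`|n|.+1)%N)//; lia.
Qed.

End Tadic.
End Laurent.

(** * Completions *)

Section DenseExtension.
Variables (R : realType) (X : fieldType) (w : X -> R).
Variables (K : completeNonarchFieldType R) (G : set (X * K)).
Hypothesis hw : nonarch_absval w.
Hypothesis G1 : G 1.
Hypothesis GB : forall x y, G x -> G y -> G (x - y).
Hypothesis GM : forall x y, G x -> G y -> G (x * y).
Hypothesis Giso : forall x, G x -> w x.1 = absv x.2.
Hypothesis Gdense : forall x e, 0 < e -> exists2 z, G z & w (x - z.1) < e.
Let hK : nonarch_absval (@absv R K) := absv_nonarch.

(** The closure of [G] in [X * K]. As [G] is the graph of an isometric homomorphism on a dense
    subring, its closure is the graph of the extension to [X]. *)
Let adherent (x : X) (y : K) := forall e, 0 < e ->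
  exists z, [/\ G z, w (x - z.1) < e & absv (y - z.2) < e].

Let adherent_total x : exists y, adherent x y.
Proof.
pose q : R := 2^-1; have q0 : 0 < q by rewrite invr_gt0.
have q1 : q < 1 by rewrite invf_lt1// ltr1n.
have /choice[z hz] n : exists z, G z /\ w (x - z.1) < q ^+ n.
  by have [z] := Gdense x (exprn_gt0 n q0); exists z.
have [n|y hy] := @complete_lim R K (fun n => (z n).2) 1 q ler01 ltac:(by rewrite ltW).

  have [[g h] [g' h']] := (hz n, hz n.+1); rewrite mul1r.
  have -> : (z n.+1).2 - (z n).2 = (z n.+1 - z n).2 by [].
  rewrite -Giso; last exact: GB.
  apply: (@absv_dist_le _ _ _ hw x); last exact: ltW.
  by rewrite (absv_distC hw) (le_trans (ltW h'))// exprS ler_piMl ?exprn_ge0// ltW.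
exists y => e e0; have [n ne] := @exp_small R q e ltac:(by rewrite ltW) e0.
have [g h] := hz n; exists (z n); split=> //; first exact: lt_trans ne.
by rewrite (le_lt_trans (hy n))// mul1r.
Qed.

Let adherent_iso x y : adherent x y -> absv y = w x.
Proof.
move=> xy; apply/eqP; rewrite eq_le !leNgt; apply/andP; split; apply/negP => h.
- have [z [Gz h1 /(absv_eql hK) zy]] := xy _ (le_lt_trans (absval_ge0 hw _) h).
  have := absvB_lt hw h h1; rewrite opprB addrC subrK Giso// -zy.
  by rewrite ltxx.
- have [z [Gz /(absv_eql hw) zx h2]] := xy _ (le_lt_trans (absval_ge0 hK _) h).
  have := absvB_lt hK h h2; rewrite opprB addrC subrK -Giso// -zx.
  by rewrite ltxx.
Qed.

Let adherentB x y x' y' : adherent x y -> adherent x' y' -> adherent (x - x') (y - y').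
Proof.
move=> xy xy' e e0; have [z [Gz h1 h2]] := xy e e0; have [z' [Gz' h1' h2']] := xy' e e0.
exists (z - z'); split; first exact: GB.
- rewrite [X in w X](_ : _ = (x - z.1) - (x' - z'.1)); first exact: (absvB_lt hw).
  by rewrite /= !opprB addrACA [RHS]addrACA [- z.1 + _]addrC.
- rewrite [X in absv X](_ : _ = (y - z.2) - (y' - z'.2)); first exact: (absvB_lt hK).
  by rewrite /= !opprB addrACA [RHS]addrACA [- z.2 + _]addrC.
Qed.

Let adherentM x y x' y' : adherent x y -> adherent x' y' -> adherent (x * x') (y * y').
Proof.
move=> xy xy' e e0.
pose d := Num.min 1 (e / (w x + w x' + 1)).
have M0 : 0 < w x + w x' + 1 by rewrite ltr_wpDl ?addr_ge0 ?(absval_ge0 hw).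
have d0 : 0 < d by rewrite lt_min ltr01 divr_gt0.
have d1 : d <= 1 by rewrite ge_min lexx.
have de : (w x + w x' + 1) * d <= e.
  by rewrite mulrC -ler_pdivlMr// ge_min lexx orbT.
have [z [Gz h1 h2]] := xy d d0; have [z' [Gz' h1' h2']] := xy' d d0.
exists (z * z'); split; first exact: GM.
- exact: (absvM_close hw h1 h1' d1 de).
- by apply: (absvM_close hK h2 h2' d1); rewrite (adherent_iso xy) (adherent_iso xy').
Qed.

Lemma dense_extension : exists tau : {rmorphism X -> K},
  (forall x, absv (tau x) = w x) /\ forall z, G z -> tau z.1 = z.2.
Proof.
have uniq x y z : adherent x y -> adherent x z -> y = z.
  move=> xy xz; apply/subr0_eq/eqP; rewrite -(absv_eq0 hK).
  by rewrite (adherent_iso (adherentB xy xz)) subrr (absv0 hw).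
have adG z : G z -> adherent z.1 z.2.
  by move=> Gz e e0; exists z; rewrite !subrr (absv0 hw) (absv0 hK).
have /choice[t ht] := adherent_total.
have tB : zmod_morphism t.
  by move=> x y; apply: uniq (ht _) _; exact: adherentB.
have tM : monoid_morphism t.
  split; first by apply: uniq (ht _) _; exact: (adG _ G1).
  by move=> x y; apply: uniq (ht _) _; exact: adherentM.
pose tZ := GRing.isZmodMorphism.Build X K t tB.
pose tR := GRing.isMonoidMorphism.Build X K t tM.
pose tau : {rmorphism X -> K} := HB.pack t tZ tR.
exists tau; split=> [x|z Gz]; first exact: (adherent_iso (ht x)).
exact: uniq (ht _) (adG _ Gz).
Qed.

End DenseExtension.

(** * Algebraic closedness of the completion *)

Section ClosedCompletion.
Variables (R : realType) (A : closedFieldType).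
Variables (K : completeNonarchFieldType R) (iota : {rmorphism A -> K}).
Hypothesis iota_dense : forall x e, 0 < e -> exists a, absv (x - iota a) < e.
Let hK : nonarch_absval (@absv R K) := absv_nonarch.

(** [P] is approximated coefficientwise by a monic [Q] over the dense closed field [A], and [y] is
    the root of [Q] nearest to [x]. *)
Let approx_root (P : {poly K}) : P \is monic -> (1 < size P)%N ->
  forall x eta, 0 < eta -> exists y,
    absv P.[y] <= eta /\ absv (x - y) ^+ (size P).-1 <= Num.max (absv P.[x]) eta.
Proof.
move=> Pm P1 x eta eta0; set n := (size P).-1; set M := Num.max _ eta.
have Pn : size P = n.+1 by rewrite /n prednK// ltnW.
have n0 : (0 < n)%N by rewrite -ltnS -Pn.
(* This bounds [y] as well as [x]: the distance |x - y| is at most 1 or at most its n-th power,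
   hence at most [M]. *)
pose b := Num.max (Num.max 1 (absv x)) M.
have b1 : 1 <= b by rewrite !le_max lexx.
have bx : absv x <= b by rewrite !le_max lexx orbT.
have bM : M <= b by rewrite le_max lexx orbT.
have b0 : 0 < b by rewrite (lt_le_trans ltr01).
(* With coefficients this close, [P] and [Q] differ by at most [eta] on the disc |z| <= b. *)
pose d := eta / b ^+ size P; have d0 : 0 < d by rewrite divr_gt0 ?exprn_gt0.
have /choice[a ha] i : exists a, absv (P`_i - iota a) < d by exact: iota_dense.
pose Q : {poly A} := 'X^n + \poly_(i < n) a i.
have Qs : size Q = n.+1 by rewrite size_polyDl size_polyXn// ltnS size_poly.
have Qm : Q \is monic.
  by rewrite monicE lead_coefDl ?size_polyXn ?ltnS ?size_poly// lead_coefXn.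
have PQ z : absv z <= b -> absv (P.[z] - (map_poly iota Q).[z]) <= eta.
  move=> zb; rewrite -hornerN -hornerD.
  have -> : eta = d * b ^+ size P by rewrite divfK// gt_eqF// exprn_gt0.
  have s : (size (P - map_poly iota Q)%R <= size P)%N.
    by rewrite (leq_trans (size_polyD _ _))// size_polyN size_map_poly Qs Pn maxnn.
  rewrite (@le_trans _ _ (d * b ^+ size (P - map_poly iota Q)))//; last first.
    by rewrite ler_wpM2l ?ler_weXn2l// ltW.
  apply: (absv_horner hK) => //; first exact: ltW.
  move=> i; have mQ : (map_poly iota Q)`_i = iota Q`_i by rewrite coef_map.
  rewrite coefB mQ coefD coefXn coef_poly.
  have [|ni|->] := ltngtP i n.
  - by rewrite add0r => _; exact: ltW.
  - by rewrite nth_default ?Pn// addr0 rmorph0 subr0 (absv0 hK) ltW.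
  - have -> : P`_n = 1 by rewrite /n -lead_coefE; apply/eqP.
    by rewrite addr0 rmorph1 subrr (absv0 hK) ltW.
have [rs Qrs] := closed_field_poly_normal Q.
rewrite (monicP Qm) scale1r in Qrs.
have rsn : size rs = n by apply: succn_inj; rewrite -Qs Qrs size_prod_XsubC.
have Qrs' : map_poly iota Q = \prod_(z <- map iota rs) ('X - z%:P).
  rewrite Qrs rmorph_prod big_map; apply: eq_bigr => z _.
  by rewrite rmorphB/= map_polyX map_polyC.
have rs0 : map iota rs != [::] by rewrite -size_eq0 size_map rsn -lt0n.
have [y [yrs h _]] := nearest_root hK x rs0.
have Qy : (map_poly iota Q).[y] = 0.
  by apply/eqP; rewrite -/(root _ _) Qrs' root_prod_XsubC.
rewrite size_map rsn -Qrs' in h.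
have {}h : absv (x - y) ^+ n <= M.
  rewrite (le_trans h)// -[X in absv X](subKr P.[x]) (absvB_le hK)//.
    by rewrite le_max lexx.
  by rewrite (le_trans (PQ _ bx))// le_max lexx orbT.
exists y; split=> //; rewrite -[P.[y]]subr0 -Qy; apply: PQ.
rewrite -[y](subKr x) (absvB_le hK)//.
have [xy1|xy1] := leP (absv (x - y)) 1; first exact: le_trans b1.
rewrite (le_trans _ bM)// (le_trans _ h)// -[X in X <= _]expr1.
by rewrite ler_weXn2l// ltW.
Qed.

(** Iterating [approx_root] with [eta] = (q^n)^j gives approximate roots with |x_(j+1) - x_j| <=
    q^j; their limit is a root. *)
Lemma completion_root (P : {poly K}) : (1 < size P)%N -> exists x, root P x.
Proof.
wlog Pm : P / P \is monic.
  move=> h P1; have P0 : P != 0 by rewrite -size_poly_gt0 ltnW.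
  have l0 : (lead_coef P)^-1 != 0 by rewrite invr_eq0 lead_coef_eq0.
  have [|| x] := h ((lead_coef P)^-1 *: P).
  - by rewrite monicE lead_coefZ mulVf ?lead_coef_eq0.
  - by rewrite size_scale.
  - by rewrite rootZ// => Px; exists x.
move=> P1; set n := (size P).-1.
have n0 : (0 < n)%N by rewrite -ltnS /n prednK// ltnW.
pose q : R := 2^-1; have q0 : 0 < q by rewrite invr_gt0.
have q1 : q < 1 by rewrite invf_lt1// ltr1n.
have q01 : 0 <= q < 1 by rewrite ltW.
have step x j := approx_root Pm P1 x (exprn_gt0 j (exprn_gt0 n q0)).
have /choice[f hf] (xj : K * nat) := step xj.1 xj.2.
pose x_ := fix x_ j := if j is j'.+1 then f (x_ j', j'.+1) else f (0, 0%N).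
have Px j : absv P.[x_ j] <= q ^+ n ^+ j.
  by case: j => [|j]; [have [] := hf (0, 0%N) | have [] := hf (x_ j, j.+1)].
have [j|l hl] := @complete_lim R K x_ 1 q ler01 q01.
  have [_ /= h] := hf (x_ j, j.+1).
  rewrite (absv_distC hK) mul1r -(@ler_pXn2r _ n)//; last 2 first.
  - by rewrite nnegrE (absval_ge0 hK).
  - by rewrite nnegrE exprn_ge0// ltW.
  have -> : (q ^+ j) ^+ n = q ^+ n ^+ j by rewrite exprAC.
  rewrite (le_trans h)// ge_max Px /= ler_wiXn2l ?exprn_ge0 ?exprn_ile1//;
  exact: ltW.
exists l; apply/eqP.
(* Writing P - P(l) = Q (X - l) bounds P(x_j) - P(l) by a constant times |x_j - l|. *)
have /factor_theorem[Q PQ] : root (P - P.[l]%:P) l.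
  by rewrite /root hornerD hornerN hornerC subrr.
pose b := Num.max 1 (absv l).
pose e := \sum_(i < size Q) absv Q`_i.
have e0 : 0 <= e by rewrite sumr_ge0// => i _; exact: (absval_ge0 hK).
have Qe i : absv Q`_i <= e.
  have [iQ|Qi] := ltnP i (size Q); last by rewrite nth_default// (absv0 hK).
  by rewrite /e (bigD1 (Ordinal iQ))//= lerDl sumr_ge0// => j _; exact: (absval_ge0 hK).
have b1 : 1 <= b by rewrite le_max lexx.
have xb j : absv (x_ j) <= b.
  rewrite -[x_ j](subKr l) (absvB_le hK)//; first by rewrite le_max lexx orbT.
  by rewrite (le_trans (hl j))// mul1r (le_trans _ b1)// exprn_ile1// ltW.
apply: (absv_geometric0 hK (B := Num.max 1 (e * b ^+ size Q)) q01) => j.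
have qj : 0 <= q ^+ j by rewrite exprn_ge0// ltW.
have -> : P.[l] = P.[x_ j] - (P - P.[l]%:P).[x_ j].
  by rewrite hornerD hornerN hornerC opprB addrC subrK.
rewrite (absvB_le hK)//.
  apply: (le_trans (Px j)); rewrite -exprM (@le_trans _ _ (q ^+ j))//.
    by rewrite ler_wiXn2l ?leq_pmull// ltW.
  by rewrite ler_peMl// le_max lexx.
rewrite PQ hornerM hornerXsubC (absvalM hK) ler_pM ?(absval_ge0 hK)//.
  by rewrite (le_trans (absv_horner hK b1 (xb j) e0 Qe))// le_max lexx orbT.
by rewrite (absv_distC hK) -[X in _ <= X]mul1r.
Qed.

End ClosedCompletion.

Lemma monic_split (K : fieldType) :
  (forall P : {poly K}, (1 < size P)%N -> exists x, root P x) ->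
  forall P : {poly K}, P \is monic -> exists rs, P = \prod_(a <- rs) ('X - a%:P).
Proof.
move=> hroot P; have [n] := ubnP (size P); elim: n P => // n IH P; rewrite ltnS => Pn Pm.
have [P1|P1] := leqP (size P) 1.
  exists [::]; rewrite big_nil; move: Pm; rewrite [P]size1_polyC// monicE.
  by rewrite lead_coefC => /eqP->.
have [x /factor_theorem[Q PQ]] := hroot P P1.
have Qm : Q \is monic by move: Pm; rewrite PQ monicMr// monicXsubC.
have [|rs Qrs] := IH Q _ Qm.
  by move: Pn; rewrite PQ size_Mmonic ?monicXsubC ?monic_neq0// size_XsubC addn2.
by exists (x :: rs); rewrite big_cons -Qrs mulrC.
Qed.

(** * Algebraic extensions of k((t)) *)

(** A nonzero term of largest absolute value strictly dominates all the others, so it cannot be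
    cancelled. *)
Lemma absv_sum_distinct (R : realType) (F : fieldType) (v : F -> R) (n : nat)
    (g : 'I_n -> F) : nonarch_absval v ->
  (forall i j, g i != 0 -> g j != 0 -> v (g i) = v (g j) -> i = j) ->
  \sum_i g i = 0 -> forall i, g i = 0.
Proof.
move=> hv inj s0 i; apply/eqP/negPn/negP => gi.
have [j _ jm] := @arg_maxP _ _ _ i xpredT (fun l => v (g l)) isT.
have jmax l : v (g l) <= v (g j) by exact: jm.
have gj : g j != 0 by rewrite -(absv_gt0 hv) (lt_le_trans _ (jmax i))// (absv_gt0 hv).
have : v (\sum_(l | l != j) g l) < v (g j).
  apply: (big_ind (fun y => v y < v (g j))) => [|x y|l lj]; first by rewrite (absv0 hv) (absv_gt0 hv).
    exact: absvD_lt.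
  rewrite lt_neqAle jmax andbT; have [->|gl] := eqVneq (g l) 0.
    by rewrite (absv0 hv) eq_sym (absv_eq0 hv).
  by apply: contra_neq lj; exact: inj.
have -> : \sum_(l | l != j) g l = - g j.
  by apply/eqP; rewrite -addr_eq0 addrC; move: s0; rewrite (bigD1 j)//= => ->.
by rewrite (absvN hv) ltxx.
Qed.

Lemma nonarch_comp (R : realType) (F A : fieldType) (f : {rmorphism F -> A})
  (v : A -> R) : nonarch_absval v -> nonarch_absval (v \o f).
Proof.
move=> hv; split=> [x|x|x y|x y] /=; first exact: absval_ge0.
- split=> [/(absval_eq0 hv)/eqP|->]; first by rewrite fmorph_eq0 => /eqP.
  by rewrite rmorph0 (absv0 hv).
- by rewrite rmorphM (absvalM hv).
- by rewrite rmorphD; exact: absvalD.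
Qed.

(* A polynomial with coefficients of absolute value 0 or 1, evaluated at an
   element of absolute value [c < 1], has absolute value [c ^+ d] where [d] is
   its lowest degree: only the polynomial and [c] matter. *)
Lemma absv_horner_trivial (R : realType) (k F1 F2 : fieldType)
    (f1 : {rmorphism k -> F1}) (f2 : {rmorphism k -> F2})
    (v1 : F1 -> R) (v2 : F2 -> R) (x1 : F1) (x2 : F2) :
  nonarch_absval v1 -> nonarch_absval v2 ->
  (forall a, a != 0 -> v1 (f1 a) = 1) -> (forall a, a != 0 -> v2 (f2 a) = 1) ->
  v1 x1 < 1 -> v2 x2 = v1 x1 ->
  forall P : {poly k}, v1 (map_poly f1 P).[x1] = v2 (map_poly f2 P).[x2].
Proof.
move=> h1 h2 t1 t2 x1c x2c P.
suff [//] : v1 (map_poly f1 P).[x1] = v2 (map_poly f2 P).[x2]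
  /\ v1 (map_poly f1 P).[x1] <= 1.
elim/poly_ind: P => [|P a [IH le1]].
  by rewrite !rmorph0 !horner0 (absv0 h1) (absv0 h2).
rewrite !rmorphD !rmorphM /= !map_polyX !map_polyC /= !hornerMXaddC.
have lt1 : v1 ((map_poly f1 P).[x1] * x1) < 1.
  rewrite (absvalM h1) (le_lt_trans _ x1c)//.
  by rewrite -[leRHS]mul1r ler_wpM2r ?(absval_ge0 h1).
have [->|a0] := eqVneq a 0.
  by rewrite !rmorph0 !addr0; split; [rewrite (absvalM h1) (absvalM h2) IH x2c|exact: ltW].
by rewrite !absvDr ?t1 ?t2// (absvalM h2) -IH x2c -(absvalM h1).
Qed.

Section LaurentExtension.
Variables (k : fieldType) (R : realType) (c : R) (hc : 0 < c < 1).
Variables (A : fieldType) (emb : {rmorphism laurent k -> A}).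
Hypothesis halg : forall x : A, algebraicOver emb x.
Let w : laurent k -> R := tadic_abs c.
Let c0 : 0 < c. Proof. by case/andP: hc. Qed.
Let c1 : c < 1. Proof. by case/andP: hc. Qed.
Let c01 : 0 <= c < 1. Proof. by rewrite ltW. Qed.

Definition lev (P : {poly laurent k}) (a : A) := (map_poly emb P).[a].

Lemma levB P Q a : lev (P - Q) a = lev P a - lev Q a.
Proof. by rewrite /lev rmorphB hornerD hornerN. Qed.
Lemma levD P Q a : lev (P + Q) a = lev P a + lev Q a.
Proof. by rewrite /lev rmorphD hornerD. Qed.
Lemma levM P Q a : lev (P * Q) a = lev P a * lev Q a.
Proof. by rewrite /lev rmorphM hornerM. Qed.
Lemma levX P n a : lev (P ^+ n) a = lev P a ^+ n.
Proof. by rewrite /lev rmorphXn horner_exp. Qed.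
Lemma levXn n a : lev 'X^n a = a ^+ n.
Proof. by rewrite /lev map_polyXn hornerXn. Qed.
Lemma levC f a : lev f%:P a = emb f.
Proof. by rewrite /lev map_polyC hornerC. Qed.

Lemma minimal_poly a : exists mu : {poly laurent k},
  [/\ mu != 0, lev mu a = 0,
      forall P : {poly laurent k}, P != 0 -> (size P < size mu)%N -> lev P a != 0
    & forall P : {poly laurent k}, lev P a = lev (P %% mu) a].
Proof.
have exn : exists n, `[< exists P : {poly laurent k}, [/\ P != 0, lev P a = 0 & size P = n] >].
  have [P P0 /eqP Pa] := halg a.
  by exists (size P); apply/asboolP; exists P.
case: (ex_minnP exn) => n /asboolP[mu [mu0 mua mun]] nmin.
exists mu; split=> // [P P0|P]; last by rewrite [P in LHS](divp_eq P mu) levD levM mua mulr0 add0r.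
rewrite ltnNge mun; apply: contraNneq => Pa; apply: nmin.
by apply/asboolP; exists P.
Qed.

Section OneAbs.
Variable v : A -> R.
Hypothesis hv : nonarch_absval v.
Hypothesis hext : forall f, v (emb f) = w f.
Let hw : nonarch_absval w.
Proof.
have -> : w = v \o emb by apply/funext => f /=; rewrite hext.
exact: nonarch_comp.
Qed.

(** Equivalence of norms on the span of 1, a, ..., a^(n-1) over the complete field k((t)), by
    induction on [n]. *)
Lemma coef_bound n a :
  (forall P : {poly laurent k}, P != 0 -> (size P <= n)%N -> lev P a != 0) ->
  exists2 B : R, 0 < B & forall P : {poly laurent k}, (size P <= n)%N ->
    forall i, w P`_i <= B * v (lev P a).
Proof.
elim: n => [|n IH] hn.
  exists 1 => // P; rewrite leqn0 size_poly_eq0 => /eqP -> i.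
  by rewrite coef0 (absv0 hw) mul1r (absval_ge0 hv).
have [P P0 Pn|B B0 hB] := IH; first by apply: hn => //; exact: leqW.
(* The power a^n has positive distance from the span of the lower ones. Otherwise some P_j(a)
   approximate -a^n to within c^j / B; by induction their coefficients are Cauchy, and the limit is
   a forbidden relation for [a]. *)
have [d d0 hd] : exists2 d : R, 0 < d & forall P : {poly laurent k},
    (size P <= n)%N -> d <= v (a ^+ n + lev P a).
  apply: contrapT => nd.
  have /choice[P hP] j : exists P : {poly laurent k},
      (size P <= n)%N /\ v (a ^+ n + lev P a) < c ^+ j / B.
    apply: contrapT => nP; apply: nd; exists (c ^+ j / B) => [|P Pn].
      by rewrite divr_gt0 ?exprn_gt0.
    by rewrite leNgt; apply/negP => h; apply: nP; exists P.
  have hw' i j : w ((P j.+1)`_i - (P j)`_i) <= c ^+ j.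
    have [[Pj hj] [Pj1 hj1]] := (hP j, hP j.+1).
    rewrite -coefB (le_trans (hB _ _ i))//.
      by rewrite (leq_trans (size_polyD _ _))// size_polyN geq_max Pj1.
    rewrite mulrC -ler_pdivlMr// levB.
    have -> : lev (P j.+1) a - lev (P j) a =
        (a ^+ n + lev (P j.+1) a) - (a ^+ n + lev (P j) a).
      by rewrite opprD addrACA subrr add0r.
    rewrite (absvB_le hv)//; last exact: ltW.
    have B'0 : 0 <= B^-1 by rewrite invr_ge0 ltW.
    rewrite (le_trans (ltW hj1))// ler_wpM2r// exprS.
    by rewrite ltW// gtr_pMl// exprn_gt0.
  have /choice[g hg] i := laurent_complete hc (hw' i).
  pose Q := \poly_(i < n) g i.
  have Qn : (size Q <= n)%N by exact: size_poly.
  have b1 : 1 <= Num.max 1 (v a) by rewrite le_max lexx.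
  have : a ^+ n + lev Q a = 0.
    apply: (absv_geometric0 hv (B := B^-1 + Num.max 1 (v a) ^+ n) c01) => j.
    have [Pj hj] := hP j.
    have -> : a ^+ n + lev Q a = (a ^+ n + lev (P j) a) + lev (Q - P j) a.
      by rewrite levB -addrA [lev (P j) a + _]addrC subrK.
    have B'0 : 0 <= B^-1 by rewrite invr_ge0 ltW.
    rewrite (absvD_le hv)//.
      apply: (le_trans (ltW hj)); rewrite mulrC ler_wpM2r ?exprn_ge0 ?(ltW c0)//.
      by rewrite lerDl exprn_ge0// (le_trans _ b1).
    have s : (size (Q - P j)%R <= n)%N.
      by rewrite (leq_trans (size_polyD _ _))// size_polyN geq_max Qn.
    have cj : 0 <= c ^+ j by rewrite exprn_ge0// ltW.
    rewrite (@le_trans _ _ (c ^+ j * Num.max 1 (v a) ^+ n))//; last first.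
      by rewrite mulrC ler_wpM2r// lerDr.
    rewrite (@le_trans _ _ (c ^+ j * Num.max 1 (v a) ^+ size (map_poly emb (Q - P j))))//; last first.
      by rewrite ler_wpM2l// ler_weXn2l// size_map_poly.
    apply: (absv_horner hv) => // [|i]; first by rewrite le_max lexx orbT.
    have -> : (map_poly emb (Q - P j))`_i = emb (Q - P j)`_i by rewrite coef_map.
    rewrite hext coefB coef_poly; case: ltnP => [_|ni]; first exact: hg.
    by rewrite nth_default ?(leq_trans Pj)// subr0 (absv0 hw).
  rewrite -levXn -levD => h.
  have sQ : size ('X^n + Q) = n.+1 by rewrite size_polyDl size_polyXn// ltnS.
  have : lev ('X^n + Q) a != 0 by apply: hn; rewrite ?sQ// -size_poly_eq0 sQ.
  by rewrite h eqxx.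
pose e := v a ^+ n; have e0 : 0 <= e by rewrite exprn_ge0 ?(absval_ge0 hv).
(* The term [d^-1] controls the top coefficient [q]. The remaining part P(a) = Q(a) - q a^n has size
   at most (1 + e/d) |Q(a)|, and [B] controls its coefficients. *)
exists (d^-1 + B * (1 + e / d)).
  by rewrite addr_gt0 ?invr_gt0// mulr_gt0// ltr_pwDl// divr_ge0// ltW.
move=> Q Qn i; pose q := Q`_n; pose P := \poly_(i < n) Q`_i.
have QP : Q = P + q%:P * 'X^n.
  apply/polyP => j; rewrite coefD coefCM coefXn coef_poly.
  have [jn|nj|->] := ltngtP j n; rewrite ?mulr0 ?addr0 ?add0r ?mulr1//.
  by rewrite nth_default// (leq_trans Qn).
have QPa : lev Q a = lev P a + emb q * a ^+ n by rewrite QP levD levM levC levXn.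
have V0 : 0 <= v (lev Q a) by exact: absval_ge0.
have qle : w q <= d^-1 * v (lev Q a).
  have [->|q0] := eqVneq q 0.
    by rewrite (absv0 hw) mulr_ge0// invr_ge0 ltW.
  rewrite mulrC ler_pdivlMr//.
  have -> : lev Q a = emb q * (a ^+ n + lev (q^-1%:P * P) a).
    by rewrite levM levC mulrDr mulrA -rmorphM divff// rmorph1 mul1r QPa addrC.
  rewrite (absvalM hv) hext ler_wpM2l ?(absval_ge0 hw)// hd//.
  by rewrite mul_polyC (leq_trans (size_scale_leq _ _))// size_poly.
have t2 : 0 <= B * (1 + e / d) by rewrite mulr_ge0 ?addr_ge0 ?divr_ge0// ltW.
have [ni|ni] := leqP n i.
  have [->|ni'] := eqVneq i n.
    by rewrite (le_trans qle)// ler_wpM2r// lerDl.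
  rewrite nth_default ?(absv0 hw)//; last by rewrite (leq_trans Qn)// ltn_neqAle eq_sym ni'.
  by rewrite mulr_ge0// addr_ge0// invr_ge0 ltW.
have -> : Q`_i = P`_i by rewrite coef_poly ni.
rewrite (le_trans (hB _ (size_poly _ _) i))//.
rewrite (@le_trans _ _ (B * (1 + e / d) * v (lev Q a)))//; last first.
  by rewrite ler_wpM2r// lerDr invr_ge0 ltW.
rewrite -mulrA ler_wpM2l//; first exact: ltW.
have -> : lev P a = lev Q a - emb q * a ^+ n by rewrite QPa addrK.
rewrite mulrDl mul1r (absvB_le hv)//.
  by rewrite lerDl mulr_ge0// divr_ge0// ltW.
rewrite (absvalM hv) hext (absvX hv) -/e mulrC -mulrA (le_trans (ler_wpM2l e0 qle))//.
by rewrite lerDr.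
Qed.

End OneAbs.

(** Suppose v(a) < v'(a). The remainder of a^N modulo the minimal polynomial has coefficients of
    size at most B v(a)^N, so v'(a)^N <= M v(a)^N for all N, which fails for large N. *)
Lemma absv_unique (v1 v2 : A -> R) : nonarch_absval v1 -> nonarch_absval v2 ->
  (forall f, v1 (emb f) = w f) -> (forall f, v2 (emb f) = w f) -> v1 =1 v2.
Proof.
suff H v v' : nonarch_absval v -> nonarch_absval v' ->
  (forall f, v (emb f) = w f) -> (forall f, v' (emb f) = w f) ->
  forall x, v' x <= v x.
  by move=> *; move=> x; apply/eqP; rewrite eq_le !H.
move=> hv hv' ext ext' a.
have [mu [mu0 mua mumin mumod]] := minimal_poly a.
have mus : (0 < size mu)%N by rewrite size_poly_gt0.
have [P P0 Ps|B B0 hB] := @coef_bound v hv ext (size mu).-1 a.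
  by apply: mumin => //; rewrite -(prednK mus).
rewrite leNgt; apply/negP => lt.
have v'0 : 0 < v' a := le_lt_trans (absval_ge0 hv _) lt.
pose b := Num.max 1 (v' a); have b1 : 1 <= b by rewrite le_max lexx.
have b0 : 0 <= b by rewrite (le_trans _ b1).
pose M := B * b ^+ size mu.
suff : 1 <= 0 :> R by rewrite ler10.
apply: (@le_geometric0 _ _ M (v a / v' a)).
  by rewrite divr_ge0 ?(absval_ge0 hv) ?(absval_ge0 hv')//= ltr_pdivrMr// mul1r.
move=> N; rewrite expr_div_n mulrA ler_pdivlMr ?exprn_gt0// mul1r -(absvX hv') -(absvX hv).
rewrite -levXn mumod; set P := _ %% mu.
have Ps : (size P < size mu)%N by rewrite ltn_modp.
have vP : v (lev P a) = v (a ^+ N) by rewrite -mumod levXn.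
have Bv : 0 <= B * v (a ^+ N) by rewrite mulr_ge0 ?(absval_ge0 hv)// ltW.
rewrite (@le_trans _ _ (B * v (a ^+ N) * b ^+ size (map_poly emb P)))//.
  apply: (absv_horner hv') => // [|i]; first by rewrite le_max lexx orbT.
  have -> : (map_poly emb P)`_i = emb P`_i by rewrite coef_map.
  by rewrite ext' -vP hB// -ltnS prednK.
by rewrite /M [leRHS]mulrAC vP ler_wpM2l// ler_weXn2l// size_map_poly ltnW.
Qed.

Section Closure.
Variable v : A -> R.
Hypothesis hv : nonarch_absval v.
Hypothesis hext : forall f, v (emb f) = w f.
Variable a : A.

(** Membership in the closure of k((t))[a]: a ring closed under limits, as [gap_krasner] demands of
    its set [S]. *)
Definition adherent_to (x : A) := forall e, 0 < e -> exists P, v (x - lev P a) < e.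

Lemma adherent_lev P : adherent_to (lev P a).
Proof. by move=> e e0; exists P; rewrite subrr (absv0 hv). Qed.

Lemma adherentB x y : adherent_to x -> adherent_to y -> adherent_to (x - y).
Proof.
move=> hx hy e e0; have [[P hP] [Q hQ]] := (hx e e0, hy e e0).
exists (P - Q); rewrite levB.
have -> : x - y - (lev P a - lev Q a) = (x - lev P a) - (y - lev Q a).
  by rewrite !opprB addrACA [RHS]addrACA [- lev P a + _]addrC.
exact: absvB_lt.
Qed.

Lemma adherentM x y : adherent_to x -> adherent_to y -> adherent_to (x * y).
Proof.
move=> hx hy e e0; pose d := Num.min 1 (e / (v x + v y + 1)).
have M0 : 0 < v x + v y + 1 by rewrite ltr_wpDl ?addr_ge0 ?(absval_ge0 hv).
have d0 : 0 < d by rewrite lt_min ltr01 divr_gt0.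
have [[P hP] [Q hQ]] := (hx d d0, hy d d0); exists (P * Q); rewrite levM.
apply: (absvM_close hv hP hQ); first by rewrite ge_min lexx.
by rewrite mulrC -ler_pdivlMr// ge_min lexx orbT.
Qed.

Lemma adherentX x n : adherent_to x -> adherent_to (x ^+ n).
Proof.
move=> hx; elim: n => [|n IH]; last by rewrite exprS; exact: adherentM.
by rewrite expr0 -(rmorph1 emb) -(levC 1 a); exact: adherent_lev.
Qed.

Lemma adherent_closed x : (forall e, 0 < e -> exists2 y, adherent_to y & v (x - y) < e) ->
  adherent_to x.
Proof.
move=> hx e e0; have [y hy xy] := hx e e0; have [P hP] := hy e e0.
by exists P; exact: absv_dist_lt xy hP.
Qed.

(* Elements of a finite extension of k((t)) have their values in a group
   containing the values of k((t)) with finite index. *)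
Lemma adherent_denominator : exists n, forall x D J, adherent_to x ->
  coprime D J -> v x ^+ D = c ^- J -> (D <= n)%N.
Proof.
have [mu [mu0 mua mumin mumod]] := minimal_poly a.
have mus : (0 < size mu)%N by rewrite size_poly_gt0.
set n := (size mu).-1; exists n => x D J hx cDJ vx.
rewrite leqNgt; apply/negP => nD; have D0 : (0 < D)%N by exact: leq_ltn_trans nD.
have vx0 : 0 < v x.
  rewrite (absv_gt0 hv); apply: contraTneq isT => x0; move: vx.
  rewrite x0 (absv0 hv) expr0n gtn_eqF//= => /esym/eqP.
  by rewrite invr_eq0 expf_eq0 gt_eqF ?andbF.
(* A value P(a) close enough to [x] has the same absolute value and replaces it. *)
have [P /(absv_eql hv) vb] := hx _ vx0; rewrite vb in vx vx0.
have mod_le Q : (size (Q %% mu)%R <= n)%N by rewrite -ltnS prednK// ltn_modp.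
(* The rows are the powers P^0, ..., P^n modulo [mu]: n + 1 vectors in dimension n, hence a linear
   relation among the powers of P(a). *)
pose M := \matrix_(i < n.+1) poly_rV (P ^+ i %% mu) : 'M_(n.+1, n).
have [i ri] : exists i, row i (kermx M) != 0.
  apply/existsP; rewrite -negb_forall; apply/negP => /forallP h.
  have : kermx M == 0 by apply/eqP/row_matrixP => i; rewrite row0; apply/eqP/h.
  rewrite kermx_eq0 /row_free => /eqP r; have := rank_leq_col M.
  by rewrite r ltnn.
pose r := row i (kermx M).
have rM : r *m M = 0 by rewrite /r -row_mul mulmx_ker row0.
pose g (j : 'I_n.+1) := emb (r 0 j) * lev P a ^+ j.
have gsum : \sum_j g j = 0.
  have -> : \sum_j g j = lev (\sum_j (r 0 j)%:P * (P ^+ j %% mu)) a.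
    rewrite /lev rmorph_sum /= horner_sum; apply: eq_bigr => j _.
    rewrite -/(lev _ _) levM levC -mumod; congr (_ * _).
    by rewrite levX.
  suff -> : \sum_j (r 0 j)%:P * (P ^+ j %% mu) = 0 by rewrite /lev rmorph0 horner0.
  apply/polyP => m; rewrite coef_sum coef0.
  have [mn|nm] := ltnP m n; last first.
    rewrite big1// => j _; rewrite coefCM nth_default ?mulr0//.
    exact: leq_trans (mod_le _) nm.
  have : (r *m M) 0 (Ordinal mn) = 0 by rewrite rM mxE.
  rewrite mxE => r0; rewrite -[RHS]r0.
  by apply: eq_bigr => j _; rewrite coefCM [M j _]mxE [poly_rV _ _ _]mxE.
have g0 := absv_sum_distinct hv _ gsum.
case/negP: ri; apply/eqP/rowP => j; rewrite [RHS]mxE.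
(* Equal sizes of terms l and j make D divide J (l - j), hence l - j, while |l - j| <= n < D. So the
   nonzero terms of the relation have distinct sizes, and all of them vanish. *)
have /g0 : forall l j, g l != 0 -> g j != 0 -> v (g l) = v (g j) -> l = j.
  move=> l {}j gl gj; rewrite /g !(absvalM hv) !(absvX hv) !hext.
  have nz l' : g l' != 0 -> r 0 l' != 0.
    by apply: contraNneq => l0; rewrite /g l0 rmorph0 mul0r.
  have [m ->] : exists m, w (r 0 l) = c ^ m := tadic_value c (nz _ gl).
  have [m' ->] : exists m, w (r 0 j) = c ^ m := tadic_value c (nz _ gj).
  move=> /(congr1 (fun y => y ^+ D)); rewrite !exprMn.
  rewrite -!exprM !(mulnC _ D) !exprM vx -!exprVn -!exprM.
  have E l' : c^-1 ^+ l' = c ^ (- l'%:Z) by rewrite exprVn -exprnN.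
  rewrite !E !exprnP !exprz_exp -!expfzDr ?gt_eqF// => /(ieexprIz c0).
  rewrite lt_eqF// => /(_ isT) eqm; apply/val_inj/eqP; apply/negPn/negP => lj.
  have h : (`|m - m'| * D = J * `|(l : int) - (j : int)|)%N.
    rewrite -{1}[D]/(`|D%:Z|)%N -{1}[J]/(`|J%:Z|)%N -!abszM; congr (`|_|)%N.
    by move: eqm; rewrite !PoszM mulrBl mulrBr; lia.
  have : (D %| `|(l : int) - (j : int)|)%N.
    by rewrite -(Gauss_dvdr _ cDJ) -h dvdn_mull.
  move=> /dvdn_leq; rewrite absz_gt0 subr_eq0 => /(_ lj).
  have := ltn_ord l; have := ltn_ord j; lia.
move=> /(_ j)/eqP; rewrite mulf_eq0 fmorph_eq0 expf_eq0.
by rewrite -(absv_eq0 hv (lev P a)) gt_eqF// andbF orbF => /eqP.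
Qed.

End Closure.
End LaurentExtension.

(** * Isometric embeddings of k((t)) into K *)

Section LaurentEmbedding.
Variables (k : fieldType) (R : realType) (c : R) (hc : 0 < c < 1).
Variables (K : completeNonarchFieldType R) (kap : {rmorphism k -> K}).
Hypothesis hw : nonarch_absval (@tadic_abs k R c).
Hypothesis kap1 : forall a, a != 0 -> absv (kap a) = 1.
Let hK : nonarch_absval (@absv R K) := absv_nonarch.

(** On Laurent polynomials the substitution of [u] for t is isometric by [absv_horner_trivial]; it
    extends to k((t)) by density. *)
Lemma laurent_embedding (u : K) : absv u = c ->
  exists phi : {rmorphism laurent k -> K},
  [/\ forall f, absv (phi f) = tadic_abs c f, forall a, phi (lconst a) = kap a
    & phi (lmon 1 1) = u].
Proof.
move=> uc; have [c0 c1] := andP hc.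
have u0 : u != 0 by rewrite -(absv_gt0 hK) uc.
pose pt m (P : {poly k}) : laurent k * K :=
  (lmon 1 m * (map_poly (@lconst k) P).[lmon 1 1], u ^ m * (map_poly kap P).[u]).
pose G := [set z | exists m P, z = pt m P].
have shift m d P : pt (m + d%:Z) P = pt m ('X^d * P).
  rewrite /pt !rmorphM /= !map_polyXn !hornerM !hornerXn lmon1X mul1r.
  by rewrite !mulrA lmonM mulr1 expfzDr.
(* Two Laurent polynomials can be written with the same factor t^l, so their difference has this
   form again. *)
have common m P m' P' : exists l Q Q', pt m P = pt l Q /\ pt m' P' = pt l Q'.
  have [mm'|m'm] := leP m m'.
    exists m, P, ('X^(`|m' - m|) * P'); split=> //; rewrite -shift; congr pt; lia.
  exists m', ('X^(`|m - m'|) * P), P'; split=> //; rewrite -shift; congr pt; lia.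
have [|z z'|z z'|z|x e e0|phi [phi_iso phiG]] := @dense_extension R _ _ K G hw.
- exists 0, 1; rewrite /pt !rmorph1 !hornerC !mulr1 expr0z -lconstE rmorph1//.
- move=> [m [P ->]] [m' [P' ->]]; have [l [Q [Q' [-> ->]]]] := common m P m' P'.
  exists l, (Q - Q'); rewrite /pt !rmorphB !hornerD !hornerN !mulrBr //.
- move=> [m [P ->]] [m' [P' ->]]; exists (m + m'), (P * P').
  have lm : lmon (1 : k) (m + m') = lmon 1 m * lmon 1 m' by rewrite lmonM mulr1.
  rewrite /pt !rmorphM !hornerM expfzDr// lm.
  have mulE (f1 f2 : laurent k) (y1 y2 : K) : (f1, y1) * (f2, y2) = (f1 * f2, y1 * y2) by [].
  by rewrite mulE; congr (_, _); exact: mulrACA.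
- move=> [m [P ->]] /=; rewrite (absvalM hw) (absvalM hK).
  have t1 : tadic_abs c (lmon (1 : k) 1) = c by rewrite tadic_mon ?oner_neq0.
  congr (_ * _); last first.
    apply: (absv_horner_trivial hw hK); rewrite ?t1//.
    by move=> b b0; rewrite [_ b]lconstE tadic_mon.
  rewrite tadic_mon ?oner_neq0// -uc.
  by case: m => n; rewrite ?NegzE -?exprnN ?(absvV hK) (absvX hK).
- have [m [P h]] := tadic_dense hc x e0; exists (pt m P) => //.
  by exists m, P.
exists phi; split=> //.
- move=> b; have /phiG : G (pt 0 b%:P) by exists 0, b%:P.
  by rewrite /= !map_polyC !hornerC /= expr0z mul1r -lconstE rmorph1 mul1r.
- have /phiG : G (pt 1 1%:P) by exists 1, 1%:P.
  by rewrite /= !map_polyC !hornerC /= expr1z !rmorph1 !mulr1.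
Qed.
End LaurentEmbedding.

(** * The relations R_m *)

(* R_m(x, z) is [gap (deg p m) (p ^ 2) x = gap (deg p m) (p ^ 1) z]. *)
Definition gap (L : pzRingType) (D q : nat) (x : L) : L := x ^+ D - x ^+ q.+1.

Lemma rmorph_gap (L L' : nzRingType) (f : {rmorphism L -> L'}) D q x :
  f (gap D q x) = gap D q (f x).
Proof. by rewrite /gap rmorphB !rmorphXn. Qed.

(** The powers D and q are additive in characteristic p, and x^(q+1) = x^q x produces the mixed
    terms. *)
Lemma gapD (L : fieldType) (p : nat) (hp : p \in [pchar L]) i j (x h : L) :
  let: D := (p ^ i)%N in let: q := (p ^ j)%N in
  gap D q (x + h) - gap D q x =
  h ^+ D - x ^+ q * h - h ^+ q * x - h ^+ q.+1.
Proof.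
have pn n : [pchar L].-nat (p ^ n)%N.
  rewrite pnatX pnatE ?hp ?(pcharf_prime hp)//.
rewrite /gap !exprSr !exprDn_pchar// mulrDr !mulrDl !opprD.
move: (x ^+ _) (h ^+ _) (x ^+ _ * x) (x ^+ _ * h) (h ^+ _ * x) (h ^+ _ * h).
move=> xD hD a b d e.
ring.
Qed.

Definition deg p m := (p ^ (2 * m + 3))%N.

Lemma deg_gt p m : (1 < p)%N -> ((p ^ 2).+1 < deg p m)%N.
Proof.
move=> p1; have p2 : (0 < p ^ 2)%N by rewrite expn_gt0 ltnW.
rewrite (@leq_trans (p ^ 3)%N) ?leq_pexp2l ?leq_addl// 1?ltnW//.
by rewrite (expnS p 2); nia.
Qed.

Lemma degS p m : deg p m.+1 = (deg p m * p ^ 2)%N.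
Proof. by rewrite /deg -expnD; congr expn; lia. Qed.

(** * The radii r_m *)

Section NthRoot.
Variables (R : realType).

Lemma nth_root_exists (y : R) n : 0 < y -> (0 < n)%N ->
  exists2 r : R, 0 < r & r ^+ n = y.
Proof.
move=> y0 n0; exists (y `^ n%:R^-1); first exact: powR_gt0.
rewrite -powR_mulrn ?powR_ge0// -powRrM mulVf ?powRr1 ?ltW//.
by rewrite pnatr_eq0 -lt0n.
Qed.

Variables (C : R) (p : nat).
Hypotheses (C1 : 1 < C) (p1 : (1 < p)%N).

(** Here r_m = C^((p^2+1)/D_m). Since D_(m+1) = p^2 D_m and p^2 + 1 <= p^3, the fourth bound holds;
    it says that for |h| <= r_(m+1) and q = p the linear term of [gapD] dominates h^(D_m). *)
Lemma radius_exists : exists r : nat -> R, forall m,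
  [/\ 1 < r m, r m < C, r m.+1 <= r m, r m.+1 ^+ (deg p m).-1 < C ^+ p
    & r m ^+ deg p m = C ^+ (p ^ 2).+1].
Proof.
have C0 : 0 < C := lt_trans ltr01 C1.
have deg0 m : (0 < deg p m)%N by rewrite (leq_ltn_trans _ (deg_gt m p1)).
have /choice[r hr] m : exists r, 0 < r /\ r ^+ deg p m = C ^+ (p ^ 2).+1.
  by have [r] := nth_root_exists (exprn_gt0 (p ^ 2).+1 C0) (deg0 m); exists r.
have r0 m : 0 < r m by have [] := hr m.
have rE m : r m ^+ deg p m = C ^+ (p ^ 2).+1 by have [] := hr m.
have nn (x : R) : 0 < x -> x \is Num.nneg by move=> x0; rewrite nnegrE ltW.
have p2 : (0 < p ^ 2)%N by rewrite expn_gt0 ltnW.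
exists r => m; split=> //.
- by rewrite -(@ltr_pXn2r _ _ (deg0 m)) ?nn// expr1n rE exprn_egt1.
- by rewrite -(@ltr_pXn2r _ _ (deg0 m)) ?nn// rE ltr_eXn2l// deg_gt.
- rewrite -(@ler_pXn2r _ _ (deg0 m.+1)) ?nn// rE degS exprM rE.
  by rewrite -exprM ler_eXn2l// leq_pmulr.
- rewrite -(@ltr_pXn2r _ _ (deg0 m.+1)) ?nn ?exprn_gt0//.
  rewrite exprAC rE -!exprM ltr_eXn2l// degS mulnCA -expnS.
  have := deg0 m; have : ((p ^ 2).+1 <= p ^ 3)%N by rewrite (expnS p 2); nia.
  by move=> h d; nia.
Qed.

End NthRoot.

(** * Solving the relations, and a Krasner lemma for them *)

Section GapAbs.
Variables (R : realType) (L : fieldType) (v : L -> R) (p : nat).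
Hypotheses (hv : nonarch_absval v) (hp : p \in [pchar L]).
Let p_gt0 : (0 < p)%N. Proof. by apply: prime_gt0; exact: pcharf_prime hp. Qed.

(** The four terms of [gapD] are estimated separately; the maximum compares the linear term x^q h
    with h^D, and C^q |h| bounds the other two. *)
Lemma gap_lipschitz i j (x h : L) (C : R) : 1 <= C -> v x = C -> v h <= C ->
  v (gap (p ^ i) (p ^ j) (x + h) - gap (p ^ i) (p ^ j) x) <=
  Num.max (C ^+ (p ^ j)) (v h ^+ (p ^ i).-1) * v h.
Proof.
move=> C1 xC hC; rewrite (gapD hp).
have h0 : 0 <= v h := absval_ge0 hv _.
set M := Num.max _ _; have M1 : C ^+ (p ^ j) <= M by rewrite le_max lexx.
have M2 : v h ^+ (p ^ i).-1 <= M by rewrite le_max lexx orbT.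
have Di : (0 < p ^ i)%N by rewrite expn_gt0 p_gt0.
have qj : (0 < p ^ j)%N by rewrite expn_gt0 p_gt0.
repeat apply: (absvB_le hv).
- by rewrite (absvX hv) -{1}(prednK Di) exprSr ler_wpM2r.
- by rewrite (absvalM hv) (absvX hv) xC ler_wpM2r.
- rewrite (absvalM hv) (absvX hv) xC -{1}(prednK qj) exprSr mulrAC ler_wpM2r//.
  rewrite (le_trans _ M1)// -{2}(prednK qj) exprSr ler_wpM2r ?(le_trans ler01)//.
  by rewrite lerXn2r// nnegrE// (le_trans ler01).
- rewrite (absvX hv) exprSr ler_wpM2r// (le_trans _ M1)//.
  by rewrite lerXn2r// nnegrE// (le_trans ler01).
Qed.

(** This is [nearest_root] for X^D - X^(q+1) - b, whose derivative is -X^q because D and q vanish in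
    [L]. *)
Lemma nearest_gap i j (x b : L) :
  (forall P : {poly L}, P \is monic -> exists rs, P = \prod_(a <- rs) ('X - a%:P)) ->
  (0 < j)%N -> ((p ^ j).+1 < p ^ i)%N -> exists y,
  [/\ gap (p ^ i) (p ^ j) y = b,
      v (x - y) ^+ (p ^ i) <= v (gap (p ^ i) (p ^ j) x - b)
    & v x ^+ (p ^ j) * v (x - y) <= v (gap (p ^ i) (p ^ j) x - b)].
Proof.
move=> hsplit j0 ji; set D := (p ^ i)%N; set q := (p ^ j)%N.
pose S : {poly L} := 'X^(q.+1) + b%:P; pose P : {poly L} := 'X^D - S.
have Ss : (size S < size ('X^D : {poly L}))%N.
  rewrite size_polyXn ltnS (leq_trans (size_polyD _ _))// geq_max size_polyXn.
  by rewrite ji (leq_trans (size_polyC_leq1 _))// (leq_trans _ ji).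
have Pm : P \is monic.
  by rewrite monicE lead_coefDl ?size_polyN// lead_coefXn.
have PE y : P.[y] = gap D q y - b.
  by rewrite !hornerE /gap opprD addrA.
have Ps : size P = D.+1 by rewrite size_polyDl ?size_polyN// size_polyXn.
have P' : P^`().[x] = - x ^+ q.
  have natp0 n m : (0 < n)%N -> (p ^ n)%:R * m = 0 :> L.
    by move=> n0; rewrite natrX (pcharf0 hp) expr0n gtn_eqF// mul0r.
  have i0 : (0 < i)%N by case: (i) ji.
  rewrite derivB derivD !derivXn derivC addr0 hornerD hornerN !hornerMn !hornerXn /=.
  rewrite -(mulr_natl _ D) -(mulr_natl _ q.+1) natp0// sub0r -addn1 natrD mulrDl mul1r.
  by rewrite natp0// add0r.
have [rs Prs] := hsplit P Pm.
have rsn : size rs = D by apply: succn_inj; rewrite -Ps Prs size_prod_XsubC.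
have rs0 : rs != [::] by rewrite -size_eq0 rsn -lt0n expn_gt0 p_gt0.
have [y [yrs]] := nearest_root hv x rs0.
rewrite -Prs rsn P' PE (absvN hv) (absvX hv) => h1 h2; exists y; split=> //.
by apply/subr0_eq/eqP; rewrite -PE -/(root P y) Prs root_prod_XsubC.
Qed.

(* Krasner's lemma for roots of [gap D q - b], by successive approximation:
   since [D] and [q] are powers of [p], the derivative of [gap D q] at [eta] is
   [- eta ^+ q], which is close to [- T ^+ q]. *)
Lemma gap_krasner (S : set L) i j (T eta e0 : L) (C r r0 : R) :
  let: D := (p ^ i)%N in let: q := (p ^ j)%N in
  (forall x y, S x -> S y -> S (x - y)) -> (forall x y, S x -> S y -> S (x * y)) ->
  (forall x, (forall e, 0 < e -> exists2 y, S y & v (x - y) < e) -> S x) ->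
  (0 < j)%N -> 1 < C -> r0 < C -> r < C -> r ^+ D.-1 < C ^+ q ->
  v T = C -> v (eta - T) <= r0 -> v (e0 - eta) <= r ->
  S T^-1 -> S e0 -> S (gap D q eta) -> S eta.
Proof.
set D := (p ^ i)%N; set q := (p ^ j)%N.
move=> SB SM Sclosed j0 C1 r0C rC rDC TC etaT e0eta ST Se0 Sb.
have C0 : 0 < C := lt_trans ltr01 C1.
have v0 x : 0 <= v x := absval_ge0 hv x.
have etaC : v eta = C.
  by rewrite -TC; apply: (absv_eqr hv); rewrite TC (le_lt_trans etaT).
have D0 : (0 < D)%N by rewrite expn_gt0 p_gt0.
have q1 : (1 < q)%N by rewrite -(expn0 p) ltn_exp2l// prime_gt1// (pcharf_prime hp).
have q0 : (0 < q)%N by exact: ltnW.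
have rr0 : 0 <= r := le_trans (v0 _) e0eta.
have r00 : 0 <= r0 := le_trans (v0 _) etaT.
have ltX x n : 0 <= x -> x < C -> (0 < n)%N -> x ^+ n < C ^+ n.
  by move=> x0 xC n0; rewrite ltrXn2r// -lt0n.
have le_pow x n : 0 <= x -> x <= r -> x ^+ n <= r ^+ n.
  by move=> x0 xr; rewrite lerXn2r.
(* [M] bounds the factors multiplying |h| in the error after one approximation step; [kappa] is the
   resulting contraction ratio. *)
pose M := Num.max (Num.max (r0 ^+ q) (r ^+ D.-1)) (Num.max (r ^+ q.-1 * C) (r ^+ q)).
have MC : M < C ^+ q.
  have Cq : C ^+ q = C ^+ q.-1 * C by rewrite -exprSr prednK.
  rewrite !gt_max rDC !ltX//= andbT Cq ltr_pM2r//.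
  by rewrite ltX// -ltnS prednK.
have M0 : 0 <= M by rewrite !le_max exprn_ge0.
pose kappa := M / C ^+ q.
have k01 : 0 <= kappa < 1.
  by rewrite divr_ge0 ?exprn_ge0 ?(ltW C0)//= ltr_pdivrMr ?exprn_gt0// mul1r.
have STq : S (T^-1 ^+ q).
  by elim: (q) q0 => // -[|n] IH _; [rewrite expr1|rewrite exprS; apply: SM => //; exact: IH].
have Sgap x : S x -> S (gap D q x).
  move=> Sx; have SX n : S (x ^+ n.+1).
    by elim: n => [|n IH]; [rewrite expr1|rewrite exprS; exact: SM].
  by apply: SB => //; rewrite -(prednK D0).
have approx n : exists2 e, S e & v (e - eta) <= r * kappa ^+ n.
  elim: n => [|n [e Se he]]; first by exists e0; rewrite ?expr0 ?mulr1.
  pose h := e - eta.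
  have hr : v h <= r.
    by rewrite (le_trans he)// -[leRHS]mulr1 ler_wpM2l// exprn_ile1//; case/andP: k01 => // ? /ltW.
  (* Newton step with derivative -T^q. It involves [eta] only through [gap D q eta], so it stays in
     [S]. *)
  exists (e - (gap D q eta - gap D q e) * T^-1 ^+ q).
    by apply: (SB) => //; apply: (SM) => //; apply: (SB) => //; exact: Sgap.
  have T0 : T ^+ q != 0 by rewrite expf_neq0// -(absv_gt0 hv) TC.
  (* The linear term survives only as (T - eta)^q h, the cost of using T^q in place of eta^q. *)
  have -> : e - (gap D q eta - gap D q e) * T^-1 ^+ q - eta =
      ((T - eta) ^+ q * h + h ^+ D - h ^+ q * eta - h ^+ q.+1) / T ^+ q.
    have -> : e = eta + h by rewrite /h addrC subrK.
    have -> : gap D q eta - gap D q (eta + h) =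
      - (h ^+ D - eta ^+ q * h - h ^+ q * eta - h ^+ q.+1).
      by rewrite -(gapD hp) [RHS]opprB.
    have pnq : [pchar L].-nat q.
      by rewrite pnatX pnatE ?hp ?(pcharf_prime hp).
    rewrite (exprDn_pchar T (- eta) pnq) (_ : (- eta) ^+ q = - eta ^+ q); last first.
      by apply: (addrI (eta ^+ q)); rewrite -(exprDn_pchar _ _ pnq) !subrr expr0n gtn_eqF.
    move: (h ^+ D) (h ^+ q * eta) (h ^+ q.+1) => a1 a2 a3.
    rewrite exprVn; move: T0; set Tq := T ^+ q => T0.
    move: (eta ^+ q) => a4.
    have -> : (Tq - a4) * h + a1 - a2 - a3 = Tq * h + (a1 - a4 * h - a2 - a3).
      by rewrite mulrBl !addrA; congr (_ - _ - _); rewrite addrAC.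
    by rewrite mulNr opprK [RHS]mulrDl (mulrC Tq) mulfK// -[_ + h + _]addrA [eta + (_ + _)]addrC addrK.
  rewrite (absvalM hv) (absvV hv) (absvX hv) TC ler_pdivrMr ?exprn_gt0//.
  have Cq0 : C ^+ q != 0 by rewrite gt_eqF ?exprn_gt0.
  have -> : r * kappa ^+ n.+1 * C ^+ q = r * kappa ^+ n * M.
    by rewrite exprSr mulrA -[LHS]mulrA (divfK Cq0).
  rewrite (@le_trans _ _ (M * v h))//; last by rewrite mulrC ler_wpM2r.
  repeat apply: (absvB_le hv).
  - apply: (absvD_le hv).
      rewrite (absvalM hv) (absvX hv) ler_wpM2r// (absv_distC hv).
      rewrite (@le_trans _ _ (r0 ^+ q))//; first by rewrite lerXn2r ?nnegrE.
      by rewrite !le_max lexx.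
    rewrite (absvX hv) -{1}(prednK D0) exprSr ler_wpM2r//.
    by rewrite (le_trans (le_pow _ _ _ hr))// !le_max lexx orbT.
  - rewrite (absvalM hv) (absvX hv) etaC -{1}(prednK q0) exprSr mulrAC ler_wpM2r//.
    rewrite (@le_trans _ _ (r ^+ q.-1 * C))//; last by rewrite !le_max lexx !orbT.
    by rewrite ler_wpM2r ?le_pow// ltW.
  - rewrite (absvX hv) exprSr ler_wpM2r//.
    by rewrite (le_trans (le_pow _ _ _ hr))// !le_max lexx !orbT.
apply: Sclosed => e egt0.
have [n hn] := @exp_small R kappa (e / (r + 1)) k01 ltac:(by rewrite divr_gt0// ltr_wpDl).
have [y Sy hy] := approx n; exists y => //; rewrite (absv_distC hv) (le_lt_trans hy)//.
have r1 : 0 < r + 1 by rewrite ltr_wpDl.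
rewrite (@le_lt_trans _ _ ((r + 1) * kappa ^+ n))//.
  by rewrite ler_wpM2r ?exprn_ge0 ?lerDl//; case/andP: k01.
by rewrite mulrC -ltr_pdivlMr.
Qed.
End GapAbs.

(** * The sequence Y_m *)

Section LimitSequence.
Variables (R : realType) (K : completeNonarchFieldType R) (p : nat).
Hypothesis hp : p \in [pchar K].
Hypothesis hsplit : forall P : {poly K}, P \is monic ->
  exists rs, P = \prod_(a <- rs) ('X - a%:P).
Variables (T : K) (C : R) (r : nat -> R).
Hypotheses (C1 : 1 < C) (TC : absv T = C).
Hypothesis hr : forall m, [/\ 1 < r m, r m < C, r m.+1 <= r m,
  r m.+1 ^+ (deg p m).-1 < C ^+ p & r m ^+ deg p m = C ^+ (p ^ 2).+1].
Let hK : nonarch_absval (@absv R K) := absv_nonarch.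
Let p1 : (1 < p)%N. Proof. by apply: prime_gt1; exact: pcharf_prime hp. Qed.

(* Each [Y m] is a limit of its approximations [app d m], where [app 0 m = T]
   and [app d.+1 m] is the solution of the relation with [app d m.+1] that is
   nearest to [app d m]. *)
Lemma gap_sequence : exists Y : nat -> K, (forall m, absv (Y m - T) <= r m) /\
  forall m, gap (deg p m) (p ^ 2) (Y m) = gap (deg p m) (p ^ 1) (Y m.+1).
Proof.
have C0 : 0 < C := lt_trans ltr01 C1.
have v0 x : 0 <= absv x := absval_ge0 hK (x : K).
have deg0 m : (0 < deg p m)%N by rewrite (leq_ltn_trans _ (deg_gt m p1)).
have rC m : r m < C by have [] := hr m.
have r_gt0 m : 0 < r m by have [r1 _ _ _ _] := hr m; exact: lt_trans r1.
have rS m : r m.+1 <= r m by have [] := hr m.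
pose c := C^-1; have c01 : 0 <= c < 1 by rewrite invr_ge0 ltW//= invf_lt1.
have [c0 c1] := andP c01.
have cd0 d : 0 <= c ^+ d by exact: exprn_ge0.
have shrink x d : 0 <= x -> x * c ^+ d <= x.
  by move=> x0; rewrite ler_piMr// exprn_ile1// ltW.
have r0 m : 0 <= r m by exact: ltW.
have /choice[near hnear] (mxz : nat * K * K) :=
  nearest_gap hK hp mxz.1.2 (gap (deg p mxz.1.1) (p ^ 1) mxz.2) hsplit
    (isT : (0 < 2)%N) (deg_gt mxz.1.1 p1).
pose app := fix app d m := if d is d'.+1 then near (m, app d' m, app d' m.+1) else T.
have appR d m : gap (deg p m) (p ^ 2) (app d.+1 m) = gap (deg p m) (p ^ 1) (app d m.+1).
  by have [] := hnear (m, app d m, app d m.+1).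
have near_T m x : absv (x - T) <= r m -> absv x = C.
  by move=> h; rewrite -TC; apply: (absv_eqr hK); rewrite TC (le_lt_trans h).
have inv d : forall m, absv (app d m - T) <= r m /\
    absv (app d.+1 m - app d m) <= r m * c ^+ d.
  elim: d => [|d IH] m.
    rewrite /= subrr (absv0 hK) mulr1; split; first exact: ltW.
    (* At x = z = T the relation fails by T^(p+1) - T^(p^2+1), of size at most C^(p^2+1) =
       r_m^(D_m). *)
    have [_ h _] := hnear (m, T, T); rewrite (absv_distC hK).
    rewrite -(@ler_pXn2r _ _ (deg0 m)) ?nnegrE ?v0 ?(ltW (r_gt0 _))//.
    have [_ _ _ _ ->] := hr m; rewrite (le_trans h)//= /gap.
    rewrite opprD addrACA subrr add0r opprK.
    rewrite addrC (absvB_le hK)// (absvX hK) TC ler_weXn2l ?ltW//.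
    by rewrite ltnS leq_pexp2l// ltnW.
  have [IHT IHd] := IH m; have [IHT' IHd'] := IH m.+1.
  have dT : absv (app d.+1 m - T) <= r m.
    by apply: (absv_dist_le hK) IHT; rewrite (le_trans IHd)// shrink.
  split=> //.
  (* Moving z by [h'] changes the right-hand side by at most C^p |h'|. The derivative in x has size
     C^(p^2), so x moves by at most C^(p-p^2) |h'| <= c |h'|. *)
  have [_ _] := hnear (m, app d.+1 m, app d.+1 m.+1).
  rewrite (near_T _ _ dT) -[near _]/(app d.+2 m) /= appR => h.
  set h' := app d.+1 m.+1 - app d m.+1 in IHd'.
  have h'r : absv h' <= r m.+1.
    by rewrite (le_trans IHd')// shrink.
  have lip := gap_lipschitz hK hp (2 * m + 3) 1 (ltW C1) (near_T _ _ IHT')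
    (le_trans h'r (ltW (rC _))).
  have hE : app d m.+1 + h' = app d.+1 m.+1 by rewrite addrC subrK.
  rewrite -/(deg p m) hE max_l in lip; last first.
    have [_ _ _ hD _] := hr m; rewrite expn1 (le_trans _ (ltW hD))//.
    by rewrite lerXn2r// nnegrE// ltW.
  rewrite (absv_distC hK) -(ler_pM2l (exprn_gt0 (p ^ 2) C0)).
  rewrite (le_trans h)// (absv_distC hK) (le_trans lip)//.
  rewrite (@le_trans _ _ (C ^+ (p ^ 1) * (r m * c ^+ d)))//.
    by rewrite ler_wpM2l ?exprn_ge0 ?(ltW C0)// (le_trans IHd')// ler_wpM2r.
  have -> : C ^+ (p ^ 1) * (r m * c ^+ d) = C ^+ (p ^ 1).+1 * (r m * c ^+ d.+1).
    rewrite [C ^+ _.+1]exprSr [c ^+ _.+1]exprS -[RHS]mulrA; congr (_ * _).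
    by rewrite [RHS]mulrCA /c mulVKf ?gt_eqF.
  rewrite ler_wpM2r ?mulr_ge0//.
  by rewrite ler_weXn2l ?ltW// ltn_exp2l.
have /choice[Y hY] m : exists y, forall d, absv (y - app d m) <= r m * c ^+ d.
  apply: (@complete_lim R K (fun d => app d m) (r m) c) => //.
  by move=> d; have [] := inv d m.
have YT m : absv (Y m - T) <= r m by have := hY m 0%N; rewrite mulr1.
exists Y; split=> // m; apply/subr0_eq.
(* Both sides of the relation converge geometrically along [app], so it passes to the limit. *)
have conv j d n : absv (gap (deg p m) (p ^ j) (Y n) - gap (deg p m) (p ^ j) (app d n))
    <= Num.max (C ^+ (p ^ j)) (C ^+ (deg p m).-1) * C * c ^+ d.
  have hd : absv (Y n - app d n) <= C * c ^+ d.
    by rewrite (le_trans (hY n d))// ler_wpM2r// ltW.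
  have hC : absv (Y n - app d n) <= C.
    by rewrite (le_trans hd)// shrink// ltW.
  have [dT _] := inv d n.
  have lip := gap_lipschitz hK hp (2 * m + 3) j (ltW C1) (near_T _ _ dT) hC.
  rewrite -/(deg p m) [app d n + _]addrC subrK in lip.
  rewrite (le_trans lip)// -mulrA ler_pM//.
    by rewrite le_max exprn_ge0 ?(ltW C0).
  rewrite ge_max le_max lexx /= le_max lerXn2r ?orbT// nnegrE//.
  exact: ltW.
pose B := Num.max (Num.max (C ^+ (p ^ 2)) (C ^+ (deg p m).-1) * C * c)
  (Num.max (C ^+ (p ^ 1)) (C ^+ (deg p m).-1) * C).
apply: (absv_geometric0 hK (B := B) c01) => d.
apply: (@absv_dist_le _ _ _ hK (gap (deg p m) (p ^ 2) (app d.+1 m))).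
  by rewrite (le_trans (conv 2%N d.+1 m))// exprS mulrA ler_wpM2r// le_max lexx.
rewrite appR (absv_distC hK) (le_trans (conv 1%N d m.+1))// ler_wpM2r//.
by rewrite le_max lexx orbT.
Qed.

End LimitSequence.

(** * The homomorphism tau and its failure to be onto *)

Theorem theorem1p2 (R : realType) (p : nat) (hp : prime p)
    (k : fieldType) (hk : p \in [pchar k])
    (c : R) (hc : 0 < c < 1)
    (K : completeNonarchFieldType R) (C : completed_alg_closure k c K) :
  exists tau : {rmorphism K -> K},
    [/\ continuous tau,
        (forall (a : k) (x : K), tau (cac_const C a * x) = cac_const C a * tau x)
      & ~ bijective tau].
Proof.
have [c0 c1] := andP hc; have p1 := prime_gt1 hp.
pose A := cac_closure C; pose emb := cac_emb C; pose iota := cac_compl C.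
pose v : A -> R := @cac_abs _ _ _ _ C.
have hv : nonarch_absval v := cac_abs_nonarch C.
have hK : nonarch_absval (@absv R K) := absv_nonarch.
have hext f : v (emb f) = tadic_abs c f := cac_abs_ext C f.
have halg : forall x : A, algebraicOver emb x := @cac_algebraic _ _ _ _ C.
have iota_iso a : absv (iota a) = v a := @cac_isometry _ _ _ _ C a.
have hw : nonarch_absval (@tadic_abs k R c).
  have -> : @tadic_abs k R c = v \o emb by apply/funext => f /=; rewrite hext.
  exact: nonarch_comp.
have iota_dense (x : K) (e : R) : 0 < e -> exists a, absv (x - iota a) < e.
  move=> e0; have [] := @cac_dense _ _ _ _ C (ball x e)^°.
  - by exists x; exact: nbhsx_ballx.
  - exact: open_interior.
  by move=> y [/interior_subset yb [a _ ay]]; exists a; move: yb; rewrite ball_absv -ay.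
have hroot := completion_root iota_dense.
have hsplit := monic_split hroot.
pose kap : {rmorphism k -> K} := iota \o (emb \o @lconst k).
have hpK : p \in [pchar K] := rmorph_pchar kap hk.
have hpA : p \in [pchar A] := rmorph_pchar (emb \o @lconst k) hk.
pose B := c^-1; have B1 : 1 < B by rewrite invf_gt1.
have B0 : 0 < B := lt_trans ltr01 B1.
have [r hr] := radius_exists B1 p1.
(* The element T = 1/t in the algebraic closure. *)
pose TA := emb (lmon 1 (-1)).
have TAB : v TA = B by rewrite hext tadic_mon ?oner_neq0.
have TB : absv (iota TA) = B by rewrite iota_iso.
have [Y [YT YR]] := gap_sequence hpK hsplit B1 TB hr.
have rB m : r m < B by have [] := hr m.
have r1 m : 1 < r m by have [] := hr m.
have YB m : absv (Y m) = B.
  by rewrite -TB; apply: (absv_eqr hK); rewrite TB (le_lt_trans (YT m)).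
have Y0 : Y 0%N != 0 by rewrite -(absv_gt0 hK) YB.
have kap1 a : a != 0 -> absv (kap a) = 1.
  move=> a0; have -> : kap a = iota (emb (lmon a 0)) by rewrite -lconstE.
  by rewrite iota_iso hext tadic_mon.
(* Sending t to 1/Y_0 sends T to Y_0. *)
have uc : absv (Y 0%N)^-1 = c by rewrite (absvV hK) YB invrK.
have [phi [phi_iso phiC phit]] := laurent_embedding hc hw kap1 uc.
have phiT : phi (lmon 1 (-1)) = Y 0%N.
  apply: (mulfI (invr_neq0 Y0)); rewrite -phit -rmorphM lmonM mulr1 phit mulVf//.
  by rewrite subrr -lconstE rmorph1.
(* The embedding of k((t)) extends algebraically to [A]; the extension is isometric because the
   absolute value on [A] is unique. *)
have [tauA tauAE] := hom_extension phi halg hroot.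
have tauA_iso x : absv (tauA x) = v x.
  have := absv_unique hc halg (nonarch_comp tauA hK) hv _ hext x; apply=> f /=.
  by rewrite tauAE phi_iso.
(* The graph of [tauA] over the dense image of [A], to be extended to [K]. *)
pose G := range (fun a => (iota a, tauA a)).
have [|z z' [a _ <-] [b _ <-]|z z' [a _ <-] [b _ <-]|z [a _ <-]|x e e0|
  tau [tau_iso tauG]] := @dense_extension R K (@absv R K) K G hK.
- by exists 1; rewrite ?rmorph1.
- by exists (a - b); rewrite ?rmorphB.
- by exists (a * b); rewrite ?rmorphM.
- by rewrite /= iota_iso tauA_iso.
- have [a ha] := iota_dense x e e0; exists (iota a, tauA a) => //.
  by exists a.
have tau_iota a : tau (iota a) = tauA a.
  by apply: (tauG (iota a, tauA a)); exists a.
exists tau; split.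
- move=> x; apply/cvg_ballP => e e0; near=> y.
  rewrite ball_absv /= -rmorphB tau_iso.
  by near: y; have := nbhsx_ballx x e e0; rewrite ball_absv.
- move=> a x; rewrite rmorphM; congr (_ * _).
  by rewrite [LHS]tau_iota tauAE phiC.
(* Surjectivity gives a preimage of T, and density an [a] in [A] within distance 1 of it. *)
move=> [sigma _ tauK].
have [a ha] := iota_dense (sigma (iota TA)) 1 ltr01.
have {}ha : absv (iota TA - tauA a) < 1.
  by rewrite -tau_iota -[X in X - _]tauK -rmorphB tau_iso.
have r_le0 m : r m <= r 0%N.
  by elim: m => // m; apply: le_trans; have [] := hr m.
have lt0 : lmon 1 (-1) != 0 :> laurent k.
  by rewrite -(absv_gt0 hw) tadic_mon ?oner_neq0.
pose S := adherent_to emb v a.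
have Sa : S a by have := adherent_lev emb hv a ('X^1); rewrite levXn expr1.
have Semb f : S (emb f) by rewrite -(levC emb f a); exact: adherent_lev.
have SGap D q x : S x -> S (gap D q x).
  by move=> Sx; apply: (adherentB hv); exact: adherentX.
have tauA_inj : injective tauA by exact: fmorph_inj.
(* Induction from eta_0 = T. The next Y is a root of a polynomial with coefficients in tau(A), which
   splits there, so it has a preimage in [A]; Krasner then places that preimage in [S]. *)
have eta m : exists2 x, S x & tauA x = Y m.
  elim: m => [|m [x Sx tx]]; first by exists TA; [exact: Semb | rewrite /TA tauAE phiT].
  have [b bE] : exists b, b = gap (deg p m) (p ^ 2) x by exists (gap (deg p m) (p ^ 2) x).
  pose P : {poly A} := 'X^(deg p m) - 'X^((p ^ 1).+1) - b%:P.
  have tPE z : (map_poly tauA P).[z] = gap (deg p m) (p ^ 1) z - tauA b.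
    by rewrite !rmorphB /= !map_polyXn map_polyC !hornerE.
  have [rs Prs] := closed_field_poly_normal P.
  have PY : root (map_poly tauA P) (Y m.+1) by rewrite /root tPE bE rmorph_gap tx YR subrr.
  have P0 : P != 0.
    apply/eqP => /(congr1 (fun Q : {poly A} => Q`_(deg p m))).
    have pD : ((p ^ 1).+1 < deg p m)%N.
      by rewrite (leq_trans _ (deg_gt m p1))// !ltnS leq_pexp2l// ltnW.
    rewrite !coefB !coefXn coefC coef0 eqxx !gtn_eqF//; last exact: leq_trans pD.
    by rewrite !subr0 => /eqP; rewrite oner_eq0.
  have [y yrs ty] : exists2 y, y \in rs & tauA y = Y m.+1.
    move: PY; rewrite Prs linearZ /= rootZ; last by rewrite fmorph_eq0 lead_coef_eq0.
    rewrite rmorph_prod /= (eq_bigr (fun z => 'X - (tauA z)%:P)); last first.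
      by move=> z _; rewrite rmorphB /= map_polyX map_polyC.
    rewrite -(big_map tauA xpredT (fun z => 'X - z%:P)) root_prod_XsubC.
    by move=> /mapP[y yrs ->]; exists y.
  exists y => //.
  have yR : gap (deg p m) (p ^ 1) y = gap (deg p m) (p ^ 2) x.
    by apply: tauA_inj; rewrite !rmorph_gap tx ty YR.
  have [_ _ _ hD _] := hr m; have [_ _ rS _ _] := hr m.
  apply: (gap_krasner hv hpA (S := S) (T := TA) (e0 := a) (C := B)
    (r := r m.+1) (r0 := r 0%N) (i := 2 * m + 3) (j := 1)) => //.
  - exact: adherentB.
  - exact: adherentM.
  - exact: adherent_closed.
  (* As [tauA] maps T to Y_0, this is |Y_(m+1) - Y_0| <= r_0; both points lie within r_0 of T. *)
  - rewrite -tauA_iso rmorphB ty /TA tauAE phiT (@absv_dist_le _ _ _ hK (iota TA))//.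
      exact: le_trans (YT _) (r_le0 _).
    by rewrite (absv_distC hK).
  (* Here |tau(a) - T| < 1 < r_(m+1) and |Y_(m+1) - T| <= r_(m+1). *)
  - rewrite -tauA_iso rmorphB ty (@absv_dist_le _ _ _ hK (iota TA))//.
      by rewrite (absv_distC hK) (le_trans (ltW ha))// ltW.
    by rewrite (absv_distC hK).
  - have -> : TA^-1 = emb (lmon 1 1); last exact: Semb.
    by rewrite -fmorphV; congr (emb _); apply: (mulIf lt0); rewrite mulVf// lmonM mulr1 subrr -lconstE rmorph1.
  - by rewrite -/(deg p m) yR; exact: SGap.
have [n hn] := adherent_denominator hc halg hv hext a.
have [x Sx tx] := eta n; have [y Sy ty] := eta n.+1.
have nD : (n < deg p n)%N.
  apply: leq_trans (ltn_expl n p1) _; apply: leq_pexp2l (ltnW p1) _.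
  exact: leq_trans (leq_pmull n (ltn0Sn 1)) (leq_addr _ _).
have : (deg p n <= n)%N; last by rewrite leqNgt nD.
(* The value of eta_(n+1) - eta_n has exponent (p^2+1)/D_n in lowest terms, as p does not divide p^2
   + 1. *)
apply: (hn (y - x) _ (p ^ 2).+1); first exact: adherentB.
  by rewrite coprimeXl// prime_coprime// -addn1 dvdn_addr ?dvdn_exp// dvdn1 gtn_eqF.
rewrite -tauA_iso rmorphB tx ty -(absvX hK).
have pnq : [pchar K].-nat (deg p n) by rewrite pnatX pnatE ?hpK.
(* Additivity of the D_n-th power and R_n leave two terms, of sizes B^(p+1) and B^(p^2+1); the
   latter dominates. *)
have -> : (Y n.+1 - Y n) ^+ deg p n = Y n.+1 ^+ (p ^ 1).+1 - Y n ^+ (p ^ 2).+1.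
  have ND : (- Y n) ^+ deg p n = - Y n ^+ deg p n.
    apply: (addrI (Y n ^+ deg p n)); rewrite -(exprDn_pchar _ _ pnq) !subrr.
    by rewrite expr0n gtn_eqF// (leq_ltn_trans _ nD).
  rewrite (exprDn_pchar _ _ pnq) ND; have := YR n; rewrite /gap => /eqP.
  by rewrite subr_eq => /eqP->; rewrite opprD opprB addrA subrKC.
rewrite (absvDr hK); first by rewrite (absvN hK) (absvX hK) YB -exprVn.
by rewrite (absvN hK) !(absvX hK) !YB ltr_eXn2l// ltnS ltn_exp2l.
Unshelve. all: by end_near.
Qed.
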